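(* For $n\ge2$, the generating polynomials $B_n^{FC}(q)$ and $D_{n+1}^{FC}(q)$ are the coefficients of $x^n$ in the following respective series: \begin{align*} B^{FC}(x)&=Q^*(x)+\frac{x^2q^3}{1-xq^2}M^*(x)M(qx),\\ D^{FC}(x)&=2Q^*(x)-M^*(x)+\frac{xq^2}{1-xq^2}M^*(x)M(qx). \end{align*}
   Context: Type $B_n$: Coxeter graph the path $t,s_1,\dots,s_{n-1}$ with $m_{ts_1}=4$, other edges $m=3$. Type $D_{n+1}$: generators $t_1,t_2,s_1,\dots,s_{n-1}$; path $s_1,\dots,s_{n-1}$ with $t_1,t_2$ each joined to $s_1$ only, all edges $m=3$. Non-adjacent vertices commute. An element of a Coxeter group $W$ is fully commutative (FC) if any of its reduced expressions can be obtained from any other one using only commutation relations; $W^{FC}(q)=\sum_wq^{\ell(w)}$ over FC elements $w$ of $W$, $\ell$ the Coxeter length. A walk of length $n$ is a sequence $P=(P_0,\dots,P_n)$ of points $P_i=(i,h_i)\in\mathbb{N}^2$ with steps in $\{(1,1),(1,-1),(1,0)\}$, each horizontal step labeled $L$ or $R$; $\operatorname{ht}(P)=\sum_{i=0}^nh_i$. $\mathcal{Q}_n$ is the set of walks of length $n$ ending at $(n,0)$, and $\mathcal{M}_n\subseteq\mathcal{Q}_n$ the set of those starting at $(0,0)$. $\mathcal{Q}^*_n$, $\mathcal{M}^*_n$ consist of the walks in $\mathcal{Q}_n$, $\mathcal{M}_n$ whose horizontal steps at height $0$ are all labeled $L$. $M(x)=\sum_{n\ge0}x^n\sum_{P\in\mathcal{M}_n}q^{\operatorname{ht}(P)}$,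 and similarly $M^*(x)$, $Q^*(x)$ for $\mathcal{M}^*_n$, $\mathcal{Q}^*_n$. *)

(* Defs.v *)
From HB Require Import structures.
From mathcomp Require Import all_boot all_order all_algebra zify.
From mathcomp Require Import boolp classical_sets functions cardinality fsbigop.

Set Implicit Arguments.
Unset Strict Implicit.
Unset Printing Implicit Defensive.

Import GRing.Theory.

Local Open Scope quotient_scope.

(* An entry [cox_m s t = 0] encodes m(s,t) = infinity. *)
Record coxmatrix (S : Type) := CoxMatrix {
  cox_m :> S -> S -> nat;
  cox_diag : forall s, cox_m s s = 1;
  cox_sym : forall s t, cox_m s t = cox_m t s;
  cox_off : forall s t, s <> t -> cox_m s t <> 1
}.

Section CoxeterGroup.
Variables (S : choiceType) (m : coxmatrix S).
Implicit Types (s t : S) (u v w : seq S).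

(* The word (st)^k. *)
Definition stpow k s t : seq S := flatten (nseq k [:: s; t]).

(* Equality of words in the presentation < S | (st)^m(s,t) = 1 >; the case
   s = t gives s^2 = 1, so that words already represent all group elements. *)
Inductive coxeq : seq S -> seq S -> Prop :=
| coxeq_refl u : coxeq u u
| coxeq_sym u v : coxeq u v -> coxeq v u
| coxeq_trans u v w : coxeq u v -> coxeq v w -> coxeq u w
| coxeq_rel u v s t : coxeq (u ++ stpow (m s t) s t ++ v) (u ++ v).

Definition coxeqb u v : bool := `[< coxeq u v >].

Lemma coxeqb_refl : reflexive coxeqb.
Proof. by move=> u; apply/asboolP; exact: coxeq_refl. Qed.

Lemma coxeqb_sym : symmetric coxeqb.
Proof. by move=> u v; apply/asboolP/asboolP; exact: coxeq_sym. Qed.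

Lemma coxeqb_trans : transitive coxeqb.
Proof.
move=> v u w /asboolP uv /asboolP vw.
by apply/asboolP; exact: coxeq_trans uv vw.
Qed.

Canonical coxeq_equiv := EquivRel coxeqb coxeqb_refl coxeqb_sym coxeqb_trans.

Definition coxgroup := {eq_quot coxeq_equiv}.

HB.instance Definition _ := Choice.on coxgroup.

Definition coxpi u : coxgroup := \pi u.

Lemma coxpiP u v : coxpi u = coxpi v <-> coxeq u v.
Proof.
split=> [/eqmodP/asboolP //|uv].
by apply/eqmodP; apply/asboolP.
Qed.

Lemma coxpi_repr (x : coxgroup) : coxpi (repr x) = x.
Proof. exact: reprK. Qed.

Lemma coxeq_cat u u' v v' :
  coxeq u u' -> coxeq v v' -> coxeq (u ++ v) (u' ++ v').
Proof.
move=> uu' vv'; apply: (@coxeq_trans _ (u' ++ v)).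
  elim: uu' v {vv'} => [a v|a b _ IH v|a b c _ IH1 _ IH2 v|a b s t v].
  - exact: coxeq_refl.
  - exact: coxeq_sym.
  - exact: coxeq_trans (IH1 v) (IH2 v).
  - by rewrite -!catA; exact: coxeq_rel.
elim: vv' u' {uu'} => [a w|a b _ IH w|a b c _ IH1 _ IH2 w|a b s t w].
- exact: coxeq_refl.
- exact: coxeq_sym.
- exact: coxeq_trans (IH1 w) (IH2 w).
- by rewrite !catA -!(catA (w ++ a)); exact: coxeq_rel.
Qed.

Lemma rev_stpow k s t : rev (stpow k s t) = stpow k t s.
Proof.
have stS j : stpow j t s ++ [:: t; s] = stpow j.+1 t s.
  elim: j => //= j IH; rewrite /stpow /= in IH *.
  by rewrite IH.
elim: k => // k IH.
by rewrite -[stpow k.+1 s t]/([:: s; t] ++ stpow k s t) rev_cat IH stS.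
Qed.

Lemma coxeq_rev u v : coxeq u v -> coxeq (rev u) (rev v).
Proof.
elim=> [a|a b _ IH|a b c _ IH1 _ IH2|a b s t].
- exact: coxeq_refl.
- exact: coxeq_sym.
- exact: coxeq_trans IH1 IH2.
- by rewrite !rev_cat rev_stpow cox_sym -catA; exact: coxeq_rel.
Qed.

Lemma coxeq_revl u : coxeq (rev u ++ u) [::].
Proof.
elim: u => [|s u IH]; first exact: coxeq_refl.
apply: coxeq_trans IH; rewrite rev_cons -cats1 -catA.
by have := coxeq_rel (rev u) u s s; rewrite cox_diag.
Qed.

Definition cox_one : coxgroup := coxpi [::].
Definition cox_mul (x y : coxgroup) : coxgroup := coxpi (repr x ++ repr y).
Definition cox_inv (x : coxgroup) : coxgroup := coxpi (rev (repr x)).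

Lemma cox_mul_pi u v : cox_mul (coxpi u) (coxpi v) = coxpi (u ++ v).
Proof. by apply/coxpiP/coxeq_cat; apply/coxpiP; rewrite coxpi_repr. Qed.

Lemma cox_inv_pi u : cox_inv (coxpi u) = coxpi (rev u).
Proof. by apply/coxpiP/coxeq_rev/coxpiP; rewrite coxpi_repr. Qed.

Lemma cox_mulA : associative cox_mul.
Proof.
move=> x y z; rewrite -[x]coxpi_repr -[y]coxpi_repr -[z]coxpi_repr.
by rewrite !cox_mul_pi catA.
Qed.

Lemma cox_mul1 : left_id cox_one cox_mul.
Proof. by move=> x; rewrite -[x]coxpi_repr cox_mul_pi. Qed.

Lemma cox_mulr1 : right_id cox_one cox_mul.
Proof. by move=> x; rewrite -[x]coxpi_repr cox_mul_pi cats0. Qed.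

Lemma cox_mulV : left_inverse cox_one cox_inv cox_mul.
Proof.
move=> x; rewrite -[x]coxpi_repr cox_inv_pi cox_mul_pi.
by apply/coxpiP; exact: coxeq_revl.
Qed.

Lemma cox_mulrV : right_inverse cox_one cox_inv cox_mul.
Proof.
move=> x; rewrite -[x]coxpi_repr cox_inv_pi cox_mul_pi.
by apply/coxpiP; rewrite -{1}(revK (repr x)); exact: coxeq_revl.
Qed.

HB.instance Definition _ := isGroup.Build coxgroup
  cox_mulA cox_mul1 cox_mulr1 cox_mulV cox_mulrV.

Definition cox_gen s : coxgroup := coxpi [:: s].

Definition cox_eval u : coxgroup := (\prod_(s <- u) cox_gen s)%g.

Lemma cox_evalE u : cox_eval u = coxpi u.
Proof.
elim: u => [|s u IH]; first by rewrite /cox_eval big_nil.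
rewrite /cox_eval big_cons -[X in (_ * X)%g]/(cox_eval u) IH.
exact: cox_mul_pi.
Qed.

Lemma cox_word_ex (x : coxgroup) :
  exists k, `[< exists2 u, cox_eval u = x & size u = k >].
Proof.
exists (size (repr x)); apply/asboolP.
by exists (repr x); rewrite // cox_evalE coxpi_repr.
Qed.

Definition cox_len (x : coxgroup) : nat := ex_minn (cox_word_ex x).

Definition reduced_expr (x : coxgroup) u : Prop :=
  cox_eval u = x /\ size u = cox_len x.

Inductive commeq : seq S -> seq S -> Prop :=
| commeq_refl u : commeq u u
| commeq_trans u v w : commeq u v -> commeq v w -> commeq u w
| commeq_swap u v s t :
    m s t = 2 -> commeq (u ++ [:: s, t & v]) (u ++ [:: t, s & v]).

Definition fully_commutative (x : coxgroup) : Prop :=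
  forall u v, reduced_expr x u -> reduced_expr x v -> commeq u v.

End CoxeterGroup.

Local Open Scope classical_set_scope.
Local Open Scope ring_scope.

(* W^FC(q) in Z[q]; meaningful when W has finitely many FC elements, since
   [\sum_(_ \in _)] over an infinite support is 0 by convention. *)
Definition FCpoly (S : choiceType) (m : coxmatrix S) : {poly int} :=
  \sum_(x \in [set x : coxgroup m | fully_commutative x])
    ('X^(cox_len x) : {poly int}).

Definition path_m (i j : nat) : nat :=
  if i == j then 1%N else if (i == j.+1) || (j == i.+1) then 3%N else 2%N.

(* [inl tt] is t and [inr i] is s_(i+1). *)
Definition B_m n (a b : unit + 'I_n.-1) : nat :=
  match a, b with
  | inl _, inl _ => 1%N
  | inl _, inr i | inr i, inl _ => if i == 0%N :> nat then 4%N else 2%N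
  | inr i, inr j => path_m i j
  end.

(* [inl true] and [inl false] are t_1 and t_2, and [inr i] is s_(i+1). *)
Definition D_m n (a b : bool + 'I_n.-1) : nat :=
  match a, b with
  | inl c, inl d => if c == d then 1%N else 2%N
  | inl _, inr i | inr i, inl _ => if i == 0%N :> nat then 3%N else 2%N
  | inr i, inr j => path_m i j
  end.

Lemma path_m_sym i j : path_m i j = path_m j i.
Proof. by rewrite /path_m eq_sym orbC. Qed.

Lemma path_m_off n (i j : 'I_n) : i <> j -> path_m i j <> 1%N.
Proof.
move=> ij; rewrite /path_m; case: eqP => [/val_inj //|_].
by case: ifP.
Qed.

Lemma B_diag n a : @B_m n a a = 1%N.
Proof. by case: a => //= i; rewrite /path_m eqxx. Qed.

Lemma B_sym n a b : @B_m n a b = B_m b a.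
Proof. by case: a b => [[]|i] [[]|j] //=; exact: path_m_sym. Qed.

Lemma B_off n a b : a <> b -> @B_m n a b <> 1%N.
Proof.
case: a b => [[]|i] [[]|j] //= ab; try by case: ifP.
by apply: path_m_off => ij; apply: ab; rewrite ij.
Qed.

Lemma D_diag n a : @D_m n a a = 1%N.
Proof. by case: a => [c|i] /=; rewrite ?/path_m eqxx. Qed.

Lemma D_sym n a b : @D_m n a b = D_m b a.
Proof.
case: a b => [c|i] [d|j] //=; first by rewrite eq_sym.
exact: path_m_sym.
Qed.

Lemma D_off n a b : a <> b -> @D_m n a b <> 1%N.
Proof.
case: a b => [c|i] [d|j] //= ab; try by case: ifP.
  by case: eqP => // cd; case: ab; rewrite cd.
by apply: path_m_off => ij; apply: ab; rewrite ij.
Qed.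

Definition coxB n : coxmatrix (unit + 'I_n.-1)%type :=
  CoxMatrix (@B_diag n) (@B_sym n) (@B_off n).

(* Type D_(n+1), of rank n + 1. *)
Definition coxDS n : coxmatrix (bool + 'I_n.-1)%type :=
  CoxMatrix (@D_diag n) (@D_sym n) (@D_off n).

Record fps (R : Type) := Fps { fcoef : nat -> R }.

HB.instance Definition _ (R : Type) := [isNew for @fcoef R].
HB.instance Definition _ (R : choiceType) := [Choice of fps R by <:].

Section FpsRing.
Variable R : comNzRingType.
Implicit Types f g h : fps R.

Lemma fpsP f g : (forall n, fcoef f n = fcoef g n) <-> f = g.
Proof.
split=> [fg|-> //]; case: f g fg => [f] [g] /= fg.
by congr Fps; apply/funext.
Qed.

Definition fps_zero : fps R := Fps (fun=> 0).
Definition fps_opp f := Fps (fun n => - fcoef f n).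
Definition fps_add f g := Fps (fun n => fcoef f n + fcoef g n).

Lemma fps_addA : associative fps_add.
Proof. by move=> f g h; apply/fpsP => n /=; rewrite addrA. Qed.

Lemma fps_addC : commutative fps_add.
Proof. by move=> f g; apply/fpsP => n /=; rewrite addrC. Qed.

Lemma fps_add0 : left_id fps_zero fps_add.
Proof. by move=> f; apply/fpsP => n /=; rewrite add0r. Qed.

Lemma fps_addN : left_inverse fps_zero fps_opp fps_add.
Proof. by move=> f; apply/fpsP => n /=; rewrite addNr. Qed.

HB.instance Definition _ := GRing.isZmodule.Build (fps R)
  fps_addA fps_addC fps_add0 fps_addN.

Definition fps_one : fps R := Fps (fun n => (n == 0%N)%:R).
Definition fps_mul f g : fps R :=
  Fps (fun n => \sum_(i < n.+1) fcoef f i * fcoef g (n - i)).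

Definition fps_trunc N f : {poly R} := \poly_(i < N) fcoef f i.

Lemma fps_mul_trunc N f g n : (n < N)%N ->
  fcoef (fps_mul f g) n = (fps_trunc N f * fps_trunc N g)`_n.
Proof.
move=> nN; rewrite coefM; apply: eq_bigr => i _; rewrite !coef_poly.
have iN : (i < N)%N by rewrite (leq_trans (ltn_ord i)).
by rewrite iN (leq_ltn_trans (leq_subr i n)).
Qed.

Lemma fps_mulC : commutative fps_mul.
Proof.
by move=> f g; apply/fpsP => n; rewrite !(@fps_mul_trunc n.+1) // mulrC.
Qed.

Lemma fps_mulA : associative fps_mul.
Proof.
move=> f g h; apply/fpsP => n.
set T := fps_trunc n.+1.
transitivity ((T f * (T g * T h))`_n).
  rewrite coefM; apply: eq_bigr => i _.
  by rewrite coef_poly ltn_ord (@fps_mul_trunc n.+1) // ltnS leq_subr.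
rewrite mulrA coefM; apply: eq_bigr => i _.
by rewrite (@fps_mul_trunc n.+1) // coef_poly ltnS leq_subr.
Qed.

Lemma fps_mul1 : left_id fps_one fps_mul.
Proof.
move=> f; apply/fpsP => n /=.
rewrite big_ord_recl /= mul1r subn0 big1 ?addr0 // => i _.
by rewrite mul0r.
Qed.

Lemma fps_mulDl : left_distributive fps_mul fps_add.
Proof.
move=> f g h; apply/fpsP => n /=.
by rewrite -big_split /=; apply: eq_bigr => i _; rewrite mulrDl.
Qed.

Lemma fps_oner_neq0 : fps_one != 0.
Proof.
by apply/eqP => /fpsP/(_ 0%N) /= /eqP; rewrite oner_eq0.
Qed.

HB.instance Definition _ := GRing.Zmodule_isComNzRing.Build (fps R)
  fps_mulA fps_mulC fps_mul1 fps_mulDl fps_oner_neq0.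

Definition fpsC (a : R) : fps R := Fps (fun n => if n == 0%N then a else 0).
Definition fpsX : fps R := Fps (fun n => (n == 1%N)%:R).

(* f(ax). *)
Definition fps_dilate (a : R) f : fps R := Fps (fun n => a ^+ n * fcoef f n).

Lemma fcoef0 n : fcoef (0 : fps R) n = 0. Proof. by []. Qed.

Lemma fcoef1 n : fcoef (1 : fps R) n = (n == 0%N)%:R. Proof. by []. Qed.

Lemma fcoefD f g n : fcoef (f + g) n = fcoef f n + fcoef g n.
Proof. by []. Qed.

Lemma fcoefN f n : fcoef (- f) n = - fcoef f n. Proof. by []. Qed.

Lemma fcoefM f g n :
  fcoef (f * g) n = \sum_(i < n.+1) fcoef f i * fcoef g (n - i).
Proof. by []. Qed.

Lemma fcoefX_lt f n k : fcoef f 0 = 0 -> (n < k)%N -> fcoef (f ^+ k) n = 0.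
Proof.
move=> f0; elim: k n => // k IH n nk.
rewrite exprS fcoefM big_ord_recl f0 mul0r add0r big1 // => i _.
by rewrite IH ?mulr0 //= /bump /=; case: n nk i => [|n] nk [i] //= hi; lia.
Qed.

End FpsRing.

Section FpsUnit.
Variable R : comUnitRingType.
Implicit Types f g h : fps R.

Definition fps_unit : {pred fps R} := fun f => fcoef f 0 \is a GRing.unit.

(* Partial sums of f^-1 = a^-1 * \sum_k (1 - a^-1 f)^k, with a = f(0). *)
Definition fps_psum f N : fps R :=
  let c := fpsC (fcoef f 0)^-1 in c * \sum_(k < N) (1 - c * f) ^+ k.

Definition fps_inv f : fps R :=
  if fps_unit f then Fps (fun n => fcoef (fps_psum f n.+1) n) else f.

Lemma fps_unit_sub f : fps_unit f ->
  fcoef (1 - fpsC (fcoef f 0)^-1 * f) 0 = 0.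
Proof.
move=> uf; rewrite fcoefD fcoefN fcoefM big_ord_recl big_ord0 /= addr0.
by rewrite mulVr // subrr.
Qed.

Lemma fps_psum_stable f n N : fps_unit f -> (n < N)%N ->
  fcoef (fps_psum f N) n = fcoef (fps_psum f n.+1) n.
Proof.
move=> uf /subnKC <-; elim: (N - n.+1)%N => [|d IH]; first by rewrite addn0.
rewrite addnS -[RHS]IH /fps_psum big_ord_recr mulrDr fcoefD.
rewrite -[RHS]addr0; congr (_ + _); rewrite fcoefM big1 // => i _.
rewrite fcoefX_lt ?mulr0 //; first exact: fps_unit_sub.
by rewrite addSn ltnS (leq_trans (leq_subr _ _)) // leq_addr.
Qed.

Lemma fps_mulVr : {in fps_unit, left_inverse 1 fps_inv *%R}.
Proof.
move=> f uf; apply/fpsP => n.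
transitivity (fcoef (fps_psum f n.+1 * f) n).
  rewrite !fcoefM; apply: eq_bigr => i _; congr (_ * _).
  have -> : fcoef (fps_inv f) i = fcoef (fps_psum f i.+1) i.
    by rewrite /fps_inv (_ : fps_unit f = true).
  by rewrite (@fps_psum_stable f i n.+1).
rewrite /fps_psum; set c := fpsC _; set g := 1 - c * f.
have -> : c * (\sum_(k < n.+1) g ^+ k) * f = 1 - g ^+ n.+1.
  rewrite -[1 in RHS](expr1n _ n.+1) subrXX.
  have -> : 1 - g = c * f by rewrite /g opprB addrC subrK.
  rewrite mulrAC; congr (_ * _).
  by apply: eq_bigr => i _; rewrite expr1n mul1r.
rewrite fcoefD fcoefN fcoefX_lt ?subr0 //.
exact: fps_unit_sub.
Qed.

Lemma fps_unitPl f g : g * f = 1 -> fps_unit f.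
Proof.
move=> gf; apply/unitrPr; exists (fcoef g 0).
have := congr1 (fun h => fcoef h 0) gf.
by rewrite fcoefM big_ord_recl big_ord0 addr0 mulrC.
Qed.

Lemma fps_inv_out : {in [predC fps_unit], fps_inv =1 id}.
Proof. by move=> f /negbTE uf; rewrite /fps_inv (_ : fps_unit f = false). Qed.

HB.instance Definition _ := GRing.ComNzRing_hasMulInverse.Build (fps R)
  fps_mulVr fps_unitPl fps_inv_out.

End FpsUnit.

Inductive step := Up | Down | HorL | HorR.

Definition step_code (s : step) : bool * bool :=
  match s with
  | Up => (true, true) | Down => (true, false)
  | HorL => (false, true) | HorR => (false, false)
  end.

Definition step_decode (c : bool * bool) : step :=
  match c with
  | (true, true) => Up | (true, false) => Down
  | (false, true) => HorL | (false, false) => HorR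
  end.

Lemma step_codeK : cancel step_code step_decode.
Proof. by case. Qed.

HB.instance Definition _ := Finite.copy step (can_type step_codeK).

(* Heights (h_0, ..., h_n) and labelled steps; since the heights determine the
   steps up to the labels L and R, [is_walk] only selects consistent pairs. *)
Definition prewalk n : Type := (n.+1.-tuple nat * n.-tuple step)%type.

HB.instance Definition _ n := Choice.on (prewalk n).

Definition wheight n (P : prewalk n) (i : nat) : nat := nth 0%N P.1 i.

Definition step_rel (h : nat) (s : step) (h' : nat) : Prop :=
  match s with
  | Up => h' = h.+1
  | Down => h = h'.+1
  | HorL | HorR => h' = h
  end.

Definition is_walk n (P : prewalk n) : Prop :=
  forall i : 'I_n, step_rel (wheight P i) (tnth P.2 i) (wheight P i.+1).

Definition ht n (P : prewalk n) : nat := (\sum_(0 <= i < n.+1) wheight P i)%N.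

Definition Qwalks n : set (prewalk n) :=
  [set P | is_walk P /\ wheight P n = 0%N].

Definition Mwalks n : set (prewalk n) :=
  [set P | Qwalks P /\ wheight P 0 = 0%N].

Definition allL n (P : prewalk n) : Prop :=
  forall i : 'I_n, wheight P i = 0%N -> tnth P.2 i <> HorR.

Definition Qstarwalks n : set (prewalk n) := [set P | Qwalks P /\ allL P].
Definition Mstarwalks n : set (prewalk n) := [set P | Mwalks P /\ allL P].

(* Used for sets of walks ending at height 0, which are finite since all
   heights are then at most n. *)
Definition walk_gf (A : forall n, set (prewalk n)) : fps {poly int} :=
  Fps (fun n => \sum_(P \in A n) ('X^(ht P) : {poly int})).

Definition Mx : fps {poly int} := walk_gf Mwalks.
Definition Mstarx : fps {poly int} := walk_gf Mstarwalks.
Definition Qstarx : fps {poly int} := walk_gf Qstarwalks.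

(* The series x and q in Z[q][[x]]. *)
Definition sx : fps {poly int} := fpsX {poly int}.
Definition sq : fps {poly int} := fpsC 'X.

Lemma unit_1_sub_xq2 : 1 - sx * sq ^+ 2 \is a GRing.unit.
Proof.
suff : fps_unit (1 - sx * sq ^+ 2) by [].
by rewrite /fps_unit fcoefD fcoefN fcoefM big_ord_recl big_ord0 mul0r addr0 subr0 unitr1.
Qed.

(* Main.v *)
Require Import Defs.
From mathcomp Require Import all_boot all_order all_algebra zify.
From mathcomp Require Import boolp classical_sets functions fsbigop.
From mathcomp Require Import ring.

Set Implicit Arguments.
Unset Strict Implicit.
Unset Printing Implicit Defensive.

Import GRing.Theory.

(** An element is fully commutative exactly when no word in the commutation
    class of one of its reduced expressions has a factor ss, or a factor to which
    a braid relation applies; conversely, such a class is the set of all reduced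
    expressions of an element ([fcword_reduced], [fc_fcword]). This is the case
    of Matsumoto's theorem that is used here, and it rests on the exchange
    condition, which comes from the parity of the number of times a reflection
    occurs in a word ([coxeq_odd_reflections]), and on the fact that the order of
    st is m(s,t), seen on an integral form of the geometric representation
    ([crystallographic_exact]). So the fully commutative elements are counted by
    commutation classes of words, with the size of the words as length.

    A commutation class is determined by its projections onto the pairs of
    noncommuting generators ([commeq_of_proj]), and since the Coxeter graph of
    type B_n is a path, projections that agree on the number of occurrences of
    each generator can be glued ([glue]). Write 0 for t and i for s_i. Two
    consecutive occurrences of i >= 1 enclose a gap of i; it contains at least two
    neighbours of i, except in 1 0 1, and at most one of these is i + 1: two
    letters i + 1 would enclose two letters i + 2, and so on past the end of the
    path ([gap_above]). Hence either neighbours alternate everywhere, or some i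
    has a gap without i + 1. In the first case the projection onto {i, i+1} is determined by the numbers of
    letters i and i + 1, which differ by at most 1, and, when they are equal and
    positive, by the letter that comes first. These are the heights and the
    labelled steps of a walk that ends at height 0, and Q^* counts such walks. In
    the second case the gap forces a convex chain s_j ... s_1 t s_1 ... s_j that
    uses up t, s_1, ..., s_(j-1); with the chain collapsed to one letter s_j the
    rest alternates, so it is a walk that starts at height 1 over j
    ([gap_conditions_realizes]). A walk from height 1 is a walk of M raised by
    one, a step down, and a walk of M^* ([first_passage]), and summing over j
    produces the geometric series in xq^2.

    In type D_(n+1) look at t_1 and t_2. If they are separated by letters s_1,
    they alternate, and merging them into a single letter t leaves an alternating
    word of type B_n; its letters t can be coloured in two ways, or in one way if
    there are none, which gives 2Q^* - M^*. Otherwise t_1 and t_2 can be made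
    adjacent, they occur only once, and erasing one of them leaves a word of type
    B_n with a single t, which is either alternating or has a chain: these are
    the terms with j = 0 and j >= 1 of the last series ([adjacent_unique],
    [adjacent_gap_conditions]). *)

(** * Words *)

Section Words.
Variable T : eqType.
Implicit Types (x y : T) (u v w : seq T).

Fixpoint altw k x y : seq T := if k is k'.+1 then x :: altw k' y x else [::].

Lemma size_altw k x y : size (altw k x y) = k.
Proof. by elim: k x y => //= k IH x y; rewrite IH. Qed.

Lemma split_first x v : x \in v ->
  exists a b, v = a ++ x :: b /\ x \notin a.
Proof.
elim: v => // y v IH; rewrite inE; case: eqVneq => [-> _|xy /IH[a [b [-> xa]]]].
  by exists [::], v.
by exists (y :: a), b; rewrite inE negb_or xy.
Qed.

Lemma count_altw_head k x y : x != y -> count_mem x (altw k x y) = uphalf k.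
Proof.
move=> xy; elim/ltn_ind: k => -[|[|k]] IH //=; first by rewrite eqxx.
by rewrite eqxx eq_sym (negbTE xy) IH //= uphalfE.
Qed.

Lemma count_altw_tail k x y : x != y -> count_mem y (altw k x y) = k./2.
Proof.
move=> xy; case: k => //= k.
by rewrite (negbTE xy) count_altw_head // eq_sym.
Qed.

Definition alternating u := sorted (fun x y => x != y) u.

Lemma alternating_altw k x y : x != y -> alternating (altw k x y).
Proof.
case: k => //= k xy.
by elim: k x y xy => //= k IH x y xy; rewrite xy IH // eq_sym.
Qed.

Lemma alternatingE u x y : alternating u -> {subset u <= pred2 x y} -> x != y ->
  u = altw (size u) x y \/ u = altw (size u) y x.
Proof.
move=> + + xy; elim: u => [|z u IH] alt sub; first by left.
have zxy := sub z (mem_head _ _).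
have sub' : {subset u <= pred2 x y} by move=> t tu; apply: sub; rewrite inE tu orbT.
have {}IH := IH (path_sorted alt) sub'.
case: u alt {sub sub'} IH => [_ _|t u /= /andP[zt _] IH].
  by case/pred2P: zxy => ->; [left|right].
case/pred2P: zxy zt => -> zt; [left|right]; congr (_ :: _);
  case: IH => IH; rewrite ?[LHS]IH //; by case: IH zt => -> _; rewrite eqxx.
Qed.

Lemma infix_alternating u v : infix u v -> alternating v -> alternating u.
Proof.
move=> /infixP[a [b ->]]; rewrite /alternating.
by move=> /cat_sorted2[_ /cat_sorted2[]].
Qed.

Lemma infix_filter (P : pred T) u v : infix u v -> infix (filter P u) (filter P v).
Proof.
by move=> /infixP[a [b ->]]; apply/infixP; rewrite !filter_cat; do 2 eexists.
Qed.

Lemma count_mem_filter (P : pred T) x v : P x ->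
  count_mem x (filter P v) = count_mem x v.
Proof.
move=> Px; rewrite count_filter; apply: eq_count => y /=.
by case: eqP => //= ->.
Qed.

Lemma filter_split (P : pred T) v a x b : filter P v = a ++ x :: b ->
  exists a' b', [/\ v = a' ++ x :: b', filter P a' = a & filter P b' = b].
Proof.
elim: v a => [|y v IH] a /=; first by case: a.
case: ifP => Py.
  case: a => [[<- <-]|z a [<- /IH[a' [b' [-> <- <-]]]]].
    by exists [::], v.
  by exists (y :: a'), b'; rewrite /= Py.
by move=> /IH[a' [b' [-> <- <-]]]; exists (y :: a'), b'; rewrite /= Py.
Qed.

Lemma filter_nil_notin (P : pred T) u x : P x -> filter P u = [::] -> x \notin u.
Proof.
move=> Px e; apply/negP => xu; have : x \in filter P u by rewrite mem_filter Px.
by rewrite e.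
Qed.

(** A repetition in the projection would come from two occurrences of one of the
    letters with neither of them in between. *)
Lemma alternating_proj v x y :
  (forall a b c, v = a ++ x :: b ++ x :: c -> x \notin b -> y \in b) ->
  (forall a b c, v = a ++ y :: b ++ y :: c -> y \notin b -> x \in b) ->
  alternating (filter (pred2 x y) v).
Proof.
move=> hx hy; set f := filter _ v.
suff h z : z = x \/ z = y -> forall a b, f <> a ++ z :: z :: b.
  have : {subset f <= pred2 x y} by move=> t; rewrite mem_filter => /andP[].
  elim: {hx hy} f h => // z f IH h sub.
  case: f IH h sub => // t f IH h sub; apply/andP; split.
    apply/eqP => zt; subst t; apply: (h z _ [::] f) => //.
    by apply/pred2P; apply: sub; rewrite mem_head.
  apply: IH => [s sxy a b e|s sf].
    by apply: (h s sxy (z :: a) b); rewrite e.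
  by apply: sub; rewrite inE sf orbT.
move=> zxy a b /filter_split[a' [b' [ev _ eb]]].
have [m [c [eb' em _]]] := filter_split (a := [::]) eb; subst b'.
have xm : x \notin m by apply: filter_nil_notin em; rewrite /= eqxx.
have ym : y \notin m by apply: filter_nil_notin em; rewrite /= eqxx orbT.
by case: zxy => ?; subst z; [move: (hx _ _ _ ev xm)|move: (hy _ _ _ ev ym)] => h;
  [move: ym|move: xm]; rewrite h.
Qed.

Lemma split_last x v : x \in v -> exists a b, v = a ++ x :: b /\ x \notin b.
Proof.
rewrite -mem_rev => /split_first[a [b [e xa]]]; exists (rev b), (rev a).
by rewrite mem_rev -[v]revK e rev_cat rev_cons cat_rcons.
Qed.

Lemma split_two x v : 1 < count_mem x v ->
  exists a b c, v = a ++ x :: b ++ x :: c /\ x \notin b.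
Proof.
move=> c2; have /split_first[a [b [ev xa]]] : x \in v.
  by rewrite -has_pred1 has_count (leq_ltn_trans _ c2).
have /split_first[b1 [b2 [eb xb]]] : x \in b.
  rewrite -has_pred1 has_count; move: c2; rewrite ev count_cat /= eqxx.
  by rewrite (count_memPn xa).
by exists a, b1, b2; rewrite ev eb.
Qed.

(** A word on a tree of letters is built from its projections by adding leaves: if
    x is a leaf attached to y, only its position relative to y is prescribed. *)
Lemma glue x y v e : x != y -> x \notin v -> {subset e <= pred2 y x} ->
  count_mem y e = count_mem y v ->
  exists w, [/\ filter (predC1 x) w = v, filter (pred2 y x) w = e &
                {subset w <= x :: v}].
Proof.
move=> xy; have yx : y != x by rewrite eq_sym.
elim: v e => [|z v IH] e.
  move=> _ sub /count_memPn ye; exists e.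
  have e_x t : t \in e -> t = x.
    by move=> te; case/pred2P: (sub t te) => // ty; move: ye; rewrite -ty te.
  split=> [||t /e_x ->]; last exact: mem_head.
    apply/eqP; rewrite -size_eq0 size_filter -leqn0 leqNgt -has_count.
    by apply/hasPn => t /e_x -> /=; rewrite eqxx.
  by apply/all_filterP/allP.
rewrite inE negb_or => /andP[xz xv] sub.
have [->|zy] := eqVneq z y; last first.
  rewrite /= (negbTE zy) => cy; have [w [w1 w2 w3]] := IH e xv sub cy.
  exists (z :: w); rewrite /= (eq_sym z x) xz (negbTE xz) (negbTE zy) w1 w2; split=> //.
  by move=> t; rewrite !inE => /predU1P[->|/w3]; rewrite ?eqxx ?orbT // inE;
    do 2 case: (t == _).
rewrite /= eqxx => cy.
have : y \in e by rewrite -has_pred1 has_count cy.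
case/split_first => a [b [ee ya]].
have a_x t : t \in a -> t = x.
  move=> ta; have te : t \in e by rewrite ee mem_cat ta.
  by case/pred2P: (sub t te) => // ty; move: ya; rewrite -ty ta.
have subb : {subset b <= pred2 y x}.
  by move=> t tb; apply: sub; rewrite ee mem_cat inE tb !orbT.
have cb : count_mem y b = count_mem y v.
  by move: cy; rewrite ee count_cat /= eqxx (count_memPn ya); lia.
have [w [w1 w2 w3]] := IH b xv subb cb.
exists (a ++ y :: w); split.
- rewrite filter_cat /= yx w1 (_ : filter _ a = [::]) //.
  apply/eqP; rewrite -size_eq0 size_filter -leqn0 leqNgt -has_count.
  by apply/hasPn => t /a_x -> /=; rewrite eqxx.
- rewrite filter_cat /= eqxx w2 ee; congr (_ ++ _).
  by apply/all_filterP/allP => t /a_x -> /=; rewrite eqxx orbT.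
- move=> t; rewrite mem_cat !inE => /or3P[/a_x ->|/eqP ->|/w3]; rewrite ?eqxx ?orbT //.
  by rewrite inE => /orP[->|->]; rewrite ?orbT.
Qed.
End Words.

Lemma eq_negb (e c : bool) : e != c -> e = ~~ c.
Proof. by case: e c => [] []. Qed.

Lemma split_unique (T : eqType) (x : T) a a' b b' : a ++ x :: b = a' ++ x :: b' ->
  x \notin a -> x \notin a' -> a = a'.
Proof.
elim: a a' => [|y a IH] [|y' a'] //=; rewrite ?inE ?negb_or.
- by case=> ->; rewrite eqxx.
- by case=> <-; rewrite eqxx.
- by case=> -> /IH e /andP[_ xa] /andP[_ /(e xa) ->].
Qed.

Lemma map_split (A B : eqType) (f : A -> B) u a x b : map f u = a ++ x :: b ->
  exists a' y b', [/\ u = a' ++ y :: b', map f a' = a, f y = x & map f b' = b].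
Proof.
elim: u a => [|z u IH] [|w a] //= [].
  by move=> <- <-; exists [::], z, u.
by move=> <- /IH[a' [y [b' [-> <- <- <-]]]]; exists (z :: a'), y, b'.
Qed.

Lemma sum_le1 a b : a + (true + b) <= 1 -> a = 0 /\ b = 0.
Proof. by rewrite addnCA -[X in _ <= X]addn0 leq_add2l leqn0 addn_eq0 =>
  /andP[/eqP -> /eqP ->]. Qed.

Lemma sum_eq1 a b : a + (true + b) = 1 -> a = 0 /\ b = 0.
Proof. by move=> e; apply: sum_le1; rewrite e. Qed.

Lemma count_pred2 (i k : nat) s : i != k ->
  count (pred2 i k) s = count_mem i s + count_mem k s.
Proof.
move=> ik; elim: s => //= x s ->; rewrite addnACA; congr (_ + _).
by case: eqP => // ->; rewrite (negbTE ik).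
Qed.

(** * Reduced words in Coxeter groups *)

Section Coxeter.
Variables (S : choiceType) (m : coxmatrix S).
Implicit Types (s t : S) (u v w a b : seq S).
Local Notation pi := (coxpi m).
Local Notation "u ~ v" := (coxeq m u v) (at level 70).

Local Open Scope group_scope.

Lemma coxpi_cat u v : pi (u ++ v) = pi u * pi v.
Proof. by symmetry; exact: cox_mul_pi. Qed.

Lemma coxpi_cons s u : pi (s :: u) = cox_gen m s * pi u.
Proof. by symmetry; exact: cox_mul_pi. Qed.

Lemma coxpi_nil : pi [::] = 1.
Proof. by []. Qed.

Lemma coxeq_ss s u : s :: s :: u ~ u.
Proof. by have := coxeq_rel m [::] u s s; rewrite cox_diag. Qed.

Lemma cox_genK s : cox_gen m s * cox_gen m s = 1.
Proof. by rewrite -coxpi_cons; apply/coxpiP/coxeq_ss. Qed.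

Lemma cox_genV s : (cox_gen m s)^-1 = cox_gen m s.
Proof. by apply: mulg1_eq; exact: cox_genK. Qed.

(** The reflections s_1 ... s_(i-1) s_i s_(i-1) ... s_1 attached to the positions
    of a word s_1 ... s_k; multiplying by one of them on the left deletes the
    letter at that position. *)
Fixpoint reflections u : seq (coxgroup m) :=
  if u is s :: u' then cox_gen m s :: [seq x ^ cox_gen m s | x <- reflections u']
  else [::].

Lemma reflections_cat u v :
  reflections (u ++ v) =
    reflections u ++ [seq x ^ (pi u)^-1 | x <- reflections v].
Proof.
elim: u => [|s u IH] /=.
  by rewrite invg1 -[LHS]map_id; apply: eq_map => x; rewrite conjg1.
rewrite IH map_cat -map_comp; congr (_ :: _ ++ _); apply: eq_map => x /=.
by rewrite -conjgM coxpi_cons invgM cox_genV.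
Qed.

Lemma stpowS k s t : stpow k.+1 s t = s :: t :: stpow k s t.
Proof. by []. Qed.

Lemma stpowD j k s t : stpow (j + k) s t = stpow j s t ++ stpow k s t.
Proof. by elim: j => [//|j IH]; rewrite addSn !stpowS IH. Qed.

Lemma stpow_shift k s t : s :: stpow k t s ++ [:: t] = stpow k.+1 s t.
Proof. by elim: k => // k IH; rewrite (stpowS k) (stpowS k.+1) -IH. Qed.

Lemma coxpi_stpow s t : pi (stpow (m s t) s t) = 1.
Proof. by apply/coxpiP; have := coxeq_rel m [::] [::] s t; rewrite cats0. Qed.

Lemma coxpi_stpowSr k s t :
  pi (stpow k.+1 s t) = pi (stpow k s t) * cox_gen m s * cox_gen m t.
Proof. by rewrite -addn1 stpowD coxpi_cat !coxpi_cons coxpi_nil mulg1 mulgA. Qed.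

Lemma reflections_stpow k s t : reflections (stpow k s t) =
  [seq pi (stpow j s t) * cox_gen m s | j <- iota 0 k.*2].
Proof.
elim: k => // k IH; rewrite doubleS /= IH mul1g; congr (_ :: _ :: _).
  by rewrite conjgE cox_genV !coxpi_cons coxpi_nil mulg1 mulgA.
rewrite -map_comp (iotaDl 2 0) -!map_comp; apply: eq_map => j /=.
rewrite !conjgE !cox_genV !mulgA -[stpow (2 + j) s t]/(stpow j.+2 s t).
by rewrite coxpi_stpowSr stpowS !coxpi_cons -!mulgA !(mulgA (pi _)).
Qed.

(** The parity with which a reflection occurs among the reflections of a word
    depends only on the group element: in the reflections of the relator
    (st)^m(s,t) the second half repeats the first one. *)
Lemma coxeq_odd_reflections u v x : u ~ v ->
  odd (count_mem x (reflections u)) = odd (count_mem x (reflections v)).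
Proof.
elim=> {u v} [//|//|u v w _ -> _ ->//|u v s t].
rewrite !reflections_cat coxpi_stpow invg1 !map_cat !count_cat !oddD.
congr (_ (+) _); rewrite -[RHS]addFb; congr (_ (+) _); last first.
  by congr (odd (count _ _)); congr map; rewrite (eq_map (@conjg1 _)) map_id.
rewrite reflections_stpow -addnn iotaD add0n -{2}(addn0 (m s t)) iotaDl map_cat.
pose F j := pi (stpow j s t) * cox_gen m s.
have -> : map F (map (addn (m s t)) (iota 0 (m s t))) = map F (iota 0 (m s t)).
  rewrite -map_comp; apply: eq_map => j /=.
  by rewrite /F stpowD coxpi_cat coxpi_stpow mul1g.
by rewrite map_cat count_cat oddD addbb.
Qed.

Lemma reflection_delete x u : x \in reflections u ->
  exists a r b, u = a ++ r :: b /\ x * pi u = pi (a ++ b).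
Proof.
elim: u x => // s u IH x;
  rewrite inE => /orP[/eqP ->|/mapP[y /IH[a [r [b [-> yu]]]] ->]].
  by exists [::], s, u; rewrite coxpi_cons mulgA cox_genK mul1g.
exists (s :: a), r, b; split=> //.
rewrite conjgE !coxpi_cons cox_genV -yu -!mulgA.
by rewrite (mulgA (cox_gen m s) (cox_gen m s)) cox_genK mul1g.
Qed.

Lemma coxeq_odd_size u v : u ~ v -> odd (size u) = odd (size v).
Proof.
elim=> {u v} [//|//|u v w _ -> _ ->//|u v s t].
rewrite !size_cat !oddD; congr (_ (+) _); rewrite -[RHS]addFb; congr (_ (+) _).
by elim: (m s t) => //= k ->.
Qed.

Definition reduced_word u := forall v, u ~ v -> size u <= size v.

Lemma cox_lenP u : exists v, [/\ u ~ v, reduced_word v & size v = cox_len (pi u)].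
Proof.
rewrite /cox_len; case: ex_minnP => k /asboolP[v vu vk] kmin.
move: vu; rewrite cox_evalE => /coxpiP vu; exists v.
split=> // [|w vw]; first exact: coxeq_sym.
rewrite vk; apply: kmin; apply/asboolP; exists w => //.
by rewrite cox_evalE; apply/coxpiP/coxeq_sym/(coxeq_trans (coxeq_sym vu)).
Qed.

Lemma reduced_size u v : reduced_word u -> reduced_word v -> u ~ v -> size u = size v.
Proof.
by move=> ru rv uv; apply/eqP; rewrite eqn_leq ru ?rv //; exact: coxeq_sym.
Qed.

Lemma reduced_wordE u : reduced_word u <-> size u = cox_len (pi u).
Proof.
have [v [uv rv vl]] := cox_lenP u; split=> [ru|ul w uw].
  by rewrite -vl; exact: reduced_size.
by rewrite ul -vl; apply: rv; exact: coxeq_trans (coxeq_sym uv) uw.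
Qed.

Lemma reduced_coxeq u v : reduced_word u -> u ~ v -> size v = size u ->
  reduced_word v.
Proof. by move=> ru uv vu w vw; rewrite vu; apply: ru; exact: coxeq_trans vw. Qed.

Lemma coxeq_cons s u v : u ~ v -> s :: u ~ s :: v.
Proof. exact: (coxeq_cat (coxeq_refl m [:: s])). Qed.

Lemma coxeq_consI s u v : s :: u ~ s :: v -> u ~ v.
Proof.
move=> /(coxeq_cons s) h; apply: coxeq_trans (coxeq_sym (coxeq_ss _ _)) _.
by apply: coxeq_trans h _; exact: coxeq_ss.
Qed.

Lemma reduced_behead s u : reduced_word (s :: u) -> reduced_word u.
Proof. by move=> ru v uv; have := ru _ (coxeq_cons s uv). Qed.

(** If a reduced word begins with s, then the reflection s occurs exactly once
    among its reflections, so it occurs an odd number of times among those of any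
    other expression. *)
Lemma reduced_head_reflection s v u :
  reduced_word (s :: v) -> u ~ s :: v -> cox_gen m s \in reflections u.
Proof.
move=> rsv usv; rewrite -has_pred1 has_count lt0n.
apply/negP => /eqP u0; have := coxeq_odd_reflections (cox_gen m s) usv.
rewrite u0 /= eqxx /=; set c := count _ _; suff -> : c = 0 by [].
apply/eqP; rewrite -leqn0 leqNgt -has_count has_pred1; apply/negP.
case/mapP => y yv /esym; rewrite conjgE cox_genV.
move/(congr1 (fun x => cox_gen m s * x)); rewrite !mulgA cox_genK mul1g.
move/mulg1_eq/(congr1 (fun x => x^-1)); rewrite invgK cox_genV => ys.
case/reflection_delete: yv => a [r [b [ev]]].
rewrite ys -coxpi_cons => /coxpiP /rsv; rewrite ev /= !size_cat /=; lia.
Qed.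

(** As lengths change by parity, a word that is not reduced after adding s
    represents an element whose length is two less than the size of the word, so s
    is a left descent of the original element. *)
Lemma nonreduced_cons s u : reduced_word u -> ~ reduced_word (s :: u) ->
  exists v, [/\ u ~ s :: v, reduced_word (s :: v) & size u = size (s :: v)].
Proof.
move=> ru nsu; have [v [suv rv vl]] := cox_lenP (s :: u).
have usv : u ~ s :: v.
  by apply: coxeq_trans (coxeq_sym (coxeq_ss s u)) _; exact: coxeq_cons.
have lt : size v < size (s :: u).
  rewrite ltnNge; apply/negP => le; apply: nsu => w suw; apply: leq_trans le _.
  by apply: rv; exact: coxeq_trans (coxeq_sym suv) suw.
have sz : size (s :: v) <= size u.
  have := coxeq_odd_size suv; move: lt => /=; rewrite ltnS leq_eqVlt.
  by case/predU1P => [->|//]; case: odd.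
have eqsz : size u = size (s :: v) by apply/eqP; rewrite eqn_leq sz andbT; exact: ru.
by exists v; split=> //; exact: reduced_coxeq ru usv _.
Qed.

Lemma altw_stpow k s t : altw k s t ++ rev (altw k t s) = stpow k s t.
Proof.
elim: k s t => // k IH s t /=.
by rewrite rev_cons -cats1 catA IH stpow_shift.
Qed.

(** The relator (st)^m(s,t) is the product of one alternating word with the
    inverse of the other ([altw_stpow]). *)
Lemma coxeq_braid s t : altw (m s t) s t ~ altw (m s t) t s.
Proof.
set k := m s t.
have h : altw k s t ++ rev (altw k t s) ~ [::].
  by rewrite altw_stpow; apply/coxpiP; exact: coxpi_stpow.
have h' := coxeq_revl m (altw k t s).
apply: coxeq_trans (coxeq_cat h (coxeq_refl m (altw k t s))); rewrite -catA.
rewrite -{1}[altw k s t]cats0; apply: coxeq_cat; first exact: coxeq_refl.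
exact: coxeq_sym.
Qed.

Lemma reflections_altw k s t x : x \in reflections (altw k s t) ->
  exists2 i, i < k & x = pi (stpow i s t) * cox_gen m s.
Proof.
elim: k s t x => // k IH s t x; rewrite inE => /orP[/eqP ->|/mapP[y /IH[i ik ->] ->]].
  by exists 0 => //; rewrite mul1g.
exists i.+1; rewrite // conjgE cox_genV coxpi_stpowSr.
rewrite !mulgA; congr (_ * _).
have <- : pi (s :: stpow i t s ++ [:: t]) =
  cox_gen m s * pi (stpow i t s) * cox_gen m t.
  by rewrite coxpi_cons coxpi_cat coxpi_cons coxpi_nil mulg1 mulgA.
by rewrite -[RHS]coxpi_stpowSr stpow_shift.
Qed.

Local Notation "u ~~ v" := (commeq m u v) (at level 70).

Lemma commeq_sym u v : u ~~ v -> v ~~ u.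
Proof.
elim=> {u v} [u|u v w _ vu _ wv|u v s t st]; first exact: commeq_refl.
  exact: commeq_trans wv vu.
by apply: commeq_swap; rewrite cox_sym.
Qed.

Lemma commeq_cat u u' v v' : u ~~ u' -> v ~~ v' -> u ++ v ~~ u' ++ v'.
Proof.
move=> uu' vv'; apply: (@commeq_trans _ _ _ (u' ++ v)).
  elim: uu' => {u u'} [u|u w u' _ h _ h'|u w s t st]; first exact: commeq_refl.
    exact: commeq_trans h h'.
  by rewrite -!catA; exact: commeq_swap.
elim: vv' => {v v'} [v|v w v' _ h _ h'|v w s t st]; first exact: commeq_refl.
  exact: commeq_trans h h'.
by rewrite !catA; exact: commeq_swap.
Qed.

Lemma commeq_cons s u v : u ~~ v -> s :: u ~~ s :: v.
Proof. exact: (commeq_cat (commeq_refl m [:: s])). Qed.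

Lemma commeq_coxeq u v : u ~~ v -> u ~ v.
Proof.
elim=> {u v} [u|u v w _ h _ h'|u v s t st]; first exact: coxeq_refl.
  exact: coxeq_trans h h'.
apply: coxeq_cat; first exact: coxeq_refl.
by have := coxeq_cat (coxeq_braid s t) (coxeq_refl m v); rewrite st.
Qed.

Lemma commeq_perm u v : u ~~ v -> perm_eq u v.
Proof.
elim=> {u v} [u|u v w _ h _ h'|u v s t st] //; first exact: perm_trans h h'.
by rewrite perm_cat2l -cat1s -(cat1s t) -(cat1s t) -(cat1s s v) perm_catCA.
Qed.

(** No two of the letters that are kept commute, so a swap moves at most one of
    them. *)
Lemma commeq_filter (p : pred S) u v :
  (forall s t, m s t = 2 -> ~~ (p s && p t)) -> u ~~ v ->
  filter p u = filter p v.
Proof.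
move=> pP; elim=> {u v} [//|u v w _ -> _ ->//|u v s t /pP].
by rewrite !filter_cat /=; case: (p s); case: (p t).
Qed.

Lemma commeq_move s u : (forall x, x \in u -> m s x = 2) -> s :: u ~~ rcons u s.
Proof.
elim: u => [_|x u IH h]; first exact: commeq_refl.
apply: (@commeq_trans _ _ _ [:: x, s & u]).
  by apply: (@commeq_swap _ m [::]); apply: h; exact: mem_head.
by apply: commeq_cons; apply: IH => y yu; apply: h; rewrite inE yu orbT.
Qed.

Lemma proj_noncomm s t : m s t <> 2 ->
  forall x y, m x y = 2 -> ~~ (pred2 s t x && pred2 s t y).
Proof.
move=> st x y xy; apply/negP => /andP[/pred2P[?|?] /pred2P[?|?]]; subst => //;
  by [rewrite cox_diag in xy | rewrite cox_sym in xy].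
Qed.

(** The letters of v that precede the first occurrence of the head s of u commute
    with s, since the projection onto s and any other letter starts with s; hence
    s can be moved to the front of v. As m(s,s) = 1, the pair (s,s) is included
    and records the number of letters s. *)
Lemma commeq_of_proj u v :
  (forall s t, m s t <> 2 -> filter (pred2 s t) u = filter (pred2 s t) v) ->
  u ~~ v.
Proof.
elim: u v => [|s u IH] v h.
  case: v h => [_|x v h]; first exact: commeq_refl.
  by have := h x x; rewrite cox_diag /= eqxx => /(_ ltac:(by [])).
have sv : s \in v.
  have : s \in filter (pred2 s s) v by rewrite -h ?cox_diag //= eqxx mem_head.
  by rewrite mem_filter => /andP[].
have [a [b [ev sa]]] := split_first sv; subst v.
have ab : a ++ s :: b ~~ s :: a ++ b.
  rewrite -cat1s catA cats1; apply: commeq_sym.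
  rewrite -[s :: a ++ b]cat_cons; apply: commeq_cat; last exact: commeq_refl.
  apply: commeq_move => x xa; apply: contrapT => sx.
  have := h s x sx; rewrite /= eqxx filter_cat /=.
  case ea: (filter _ a) => [|y c] /=; last first.
    case=> ys _; have : y \in filter (pred2 s x) a by rewrite ea mem_head.
    by rewrite mem_filter -ys (negbTE sa) andbF.
  have : x \in filter (pred2 s x) a by rewrite mem_filter xa /= eqxx orbT.
  by rewrite ea.
apply: commeq_trans (commeq_sym ab); apply: commeq_cons; apply: IH => x y xy.
have := h x y xy; rewrite (commeq_filter (proj_noncomm xy) ab) /=.
by case: ifP => // _ [].
Qed.

Definition forbidden u := exists a b s t,
  u = a ++ [:: s, s & b] \/ (2 < m s t /\ u = a ++ altw (m s t) s t ++ b).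

Definition fcword u := forall v, u ~~ v -> ~ forbidden v.

Lemma fcword_commeq u v : u ~~ v -> fcword u -> fcword v.
Proof. by move=> uv fu w vw; apply: fu; exact: commeq_trans uv vw. Qed.

Lemma fcword_behead s u : fcword (s :: u) -> fcword u.
Proof.
move=> fu v /(commeq_cons s)/fu nf [a [b [x [y h]]]]; apply: nf.
case: h => [->|[xy ->]].
  by exists (s :: a), b, x, y; left.
by exists (s :: a), b, x, y; right.
Qed.

Section Exact.
Hypothesis m_gt0 : forall s t, 0 < m s t.
Hypothesis m_exact : forall s t, s <> t ->
  forall i, 0 < i < m s t -> ~ stpow i s t ~ [::].

(** Exchange applied to the descent t deletes a letter of the expression on the
    left. If that letter belonged to the alternating prefix, (st)^i would be 1
    for some i < m(s,t); so it lies in b, and the alternating prefix grows. *)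
Lemma altw_extend k s t b v : s <> t -> k < m s t ->
  reduced_word (t :: v) -> altw k s t ++ b ~ t :: v ->
  exists b', t :: v ~ altw k.+1 t s ++ b' /\ size b = size b' + 1.
Proof.
move=> st km rv /[dup] eqv /(reduced_head_reflection rv).
rewrite reflections_cat mem_cat => /orP[/reflections_altw[i ik ti]|].
  case: (@m_exact s t st i.+1); first by rewrite (leq_trans _ km).
  by apply/coxpiP; rewrite coxpi_stpowSr -ti cox_genK.
case/mapP => y /reflection_delete[b1 [r [b2 [eb yb]]]] ty.
exists (b1 ++ b2); split; last by rewrite eb !size_cat /=; lia.
apply: coxeq_trans (coxeq_sym eqv) _; apply/coxpiP.
have y_eq : cox_gen m t * pi (altw k s t) = pi (altw k s t) * y.
  by rewrite ty conjgE invgK !mulgA mulgVK.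
rewrite /= coxpi_cons !(coxpi_cat (altw k s t)) -yb.
by rewrite (mulgA (pi (altw k s t)) y) -y_eq !mulgA cox_genK mul1g.
Qed.

(** An element with two left descents s and t has reduced expressions that start
    with the longest element of the dihedral group generated by s and t: extend
    the alternating prefix by exchanging s and t in turn. *)
Lemma two_descents s t u v k : s <> t ->
  reduced_word (s :: u) -> reduced_word (t :: v) -> s :: u ~ t :: v ->
  0 < k <= m s t ->
  (exists b, s :: u ~ altw k s t ++ b /\ size (s :: u) = k + size b) /\
  (exists b, s :: u ~ altw k t s ++ b /\ size (s :: u) = k + size b).
Proof.
move=> st rs rt e; elim: k => // -[_ _|k IH /andP[_ km]].
  split; first by exists u; split=> //; exact: coxeq_refl.
  by exists v; split=> //; rewrite (reduced_size rs rt e).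
have {}IH := IH (ltnW km : 0 < k.+1 <= m s t).
have [[b [eb sb]] [c [ec sc]]] := IH.
have ts : t <> s by move/esym.
split; last first.
  have [|b' [e1 e2]] := @altw_extend _ _ _ b _ st km rt.
    by apply: coxeq_trans e; exact: coxeq_sym.
  by exists b'; split; [exact: coxeq_trans e e1|rewrite sb e2; lia].
have km' : k.+1 < m t s by rewrite cox_sym.
have [|c' [e1 e2]] := @altw_extend _ _ _ c _ ts km' rs.
  exact: coxeq_sym.
by exists c'; split=> //; rewrite sc e2; lia.
Qed.

(** The case of fully commutative elements of Matsumoto's theorem: no braid
    relation can be applied in the commutation class of such a word, so the
    class consists of all reduced expressions of its element. *)
Lemma fcword_reduced u : fcword u ->
  reduced_word u /\ forall v, reduced_word v -> u ~ v -> u ~~ v.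
Proof.
have [k] := ubnP (size u); elim: k u => // k IH [_ _|s u /= uk fsu].
  split=> // v rv /coxeq_sym/rv; case: v {rv} => // _; exact: commeq_refl.
have fu := fcword_behead fsu; have [ru uv] := IH u uk fu.
have rsu : reduced_word (s :: u).
  apply: contrapT => /(nonreduced_cons ru)[v [usv rsv _]].
  apply: (fsu (s :: s :: v)); last by exists [::], v, s, s; left.
  exact/commeq_cons/uv.
split=> // v rv e; case: v rv e => [_ /rsu //|t v rtv e].
have rv := reduced_behead rtv.
(* Both s and t are left descents of the element, hence [two_descents] applies. *)
have [est|st] := pselect (s = t).
  by subst t; apply: commeq_cons; apply: uv => //; exact: coxeq_consI e.
have m2 : 1 < m s t by have := m_gt0 s t; have := @cox_off _ m _ _ st;
  case: (m s t) => [|[]].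
have [|[b [eb sb]] _] := two_descents st rsu rtv e (k := m s t).
  by rewrite leqnn ltnW.
have : u ~~ altw (m s t).-1 t s ++ b.
  case: (m s t) m2 eb sb => // j _ /= /coxeq_consI eb [sb].
  by apply: uv => //; apply: (reduced_coxeq ru eb); rewrite size_cat size_altw; lia.
move=> /(commeq_cons s); rewrite -cat_cons.
rewrite (_ : s :: altw _ t s = altw (m s t) s t); last by case: (m s t) m2.
move=> ub.
(* If m(s,t) >= 3, a braid relation applies in the commutation class of s :: u; if
   m(s,t) = 2, then t can be moved to the front of s :: u. *)
have [m3|] := ltnP 2 (m s t).
  by case: (fsu _ ub); exists [::], b, s, t; right.
rewrite leq_eqVlt ltnNge m2 orbF => /eqP m2E; rewrite m2E /= in ub eb sb.
have ub' : s :: u ~~ [:: t, s & b].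
  by apply: commeq_trans ub _; exact: (commeq_swap [::]).
have fsb := fcword_behead (fcword_commeq ub' fsu).
have sbv : s :: b ~ v.
  by apply: (@coxeq_consI t); apply: coxeq_trans e; apply: coxeq_sym;
    exact: commeq_coxeq.
have [|_ h] := IH (s :: b) _ fsb; first by move: sb uk => /=; lia.
by apply: commeq_trans ub' _; apply: commeq_cons; apply: h.
Qed.

Lemma fcword_fc u : fcword u ->
  fully_commutative (coxpi m u) /\ cox_len (coxpi m u) = size u.
Proof.
move=> /fcword_reduced[ru h]; split; last by symmetry; exact/reduced_wordE.
move=> v w [ev sv] [ew sw]; rewrite cox_evalE in ev; rewrite cox_evalE in ew.
have uv : u ~ v by apply/coxpiP.
have uw : u ~ w by apply/coxpiP.
apply: (@commeq_trans _ _ _ u); [apply: commeq_sym|]; apply: h => //;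
  by apply/reduced_wordE; rewrite ?sv ?sw ?ev ?ew.
Qed.

End Exact.

(** A braid relation changes the order in which s and t occur, so it leaves the
    commutation class. *)
Lemma fc_fcword u : reduced_word u -> fully_commutative (coxpi m u) -> fcword u.
Proof.
move=> ru fc v uv.
have uv' := commeq_coxeq uv.
have rv : reduced_word v.
  by apply: reduced_coxeq ru uv' _; rewrite (perm_size (commeq_perm uv)).
case=> a [b [s [t [ev|[st ev]]]]]; subst v.
  have e : a ++ [:: s, s & b] ~ a ++ b.
    by apply: coxeq_cat (coxeq_ss _ _); exact: coxeq_refl.
  by have := rv _ e; rewrite !size_cat /=; lia.
set k := m s t in st rv uv uv'.
have e : a ++ altw k s t ++ b ~ a ++ altw k t s ++ b.
  apply: coxeq_cat; first exact: coxeq_refl.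
  apply: coxeq_cat (coxeq_refl _ _); exact: coxeq_braid.
have re : reduced_expr (coxpi m u) (a ++ altw k t s ++ b).
  split; first by rewrite cox_evalE; apply/coxpiP/coxeq_sym/(coxeq_trans uv').
  rewrite -(proj1 (reduced_wordE u) ru) (perm_size (commeq_perm uv)).
  by rewrite !size_cat !size_altw.
have re0 : reduced_expr (coxpi m u) u.
  by split; [rewrite cox_evalE|exact/reduced_wordE].
have c := commeq_trans (commeq_sym uv) (fc _ _ re0 re).
have st3 : 2 < m s t by [].
have st2 : m s t <> 2 by rewrite -/k => k2; rewrite k2 in st.
have := commeq_filter (proj_noncomm st2) c; rewrite !filter_cat => /eqP.
rewrite eqseq_cat // eqxx /=.
case: k st {rv uv uv' e re c} => // k _ /=;
  rewrite !eqxx /= orbT /= => /andP[/eqP est _].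
by move: st3; rewrite est cox_diag.
Qed.
End Coxeter.

Section Gaps.
Variables (S : choiceType) (m : coxmatrix S).
Implicit Types (s t x y z : S) (a b c d u v w : seq S).
Local Notation "u ~~ v" := (commeq m u v) (at level 70).

Lemma commeq_right s b w : (forall x, x \in b -> m s x = 2) ->
  s :: b ++ w ~~ b ++ s :: w.
Proof.
move=> sb; rewrite -cat_cons -cat_rcons; apply: commeq_cat (commeq_refl _ _).
exact: commeq_move.
Qed.

Lemma commeq_left s b w : (forall x, x \in b -> m s x = 2) ->
  b ++ s :: w ~~ s :: b ++ w.
Proof. by move=> sb; apply: commeq_sym; exact: commeq_right. Qed.

Lemma commeq_catl a u v : u ~~ v -> a ++ u ~~ a ++ v.
Proof. exact: commeq_cat (commeq_refl _ _). Qed.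

(** Two occurrences of a letter with only commuting letters in between could be
    brought together. *)
Lemma fcword_gap a z b c : fcword m (a ++ z :: b ++ z :: c) ->
  exists2 y, y \in b & m z y <> 2.
Proof.
move=> fw; apply: contrapT => nb.
have zb x : x \in b -> m z x = 2 by move=> xb; apply: contrapT => zx; apply: nb;
  exists x.
apply: (fw (a ++ b ++ z :: z :: c)); first exact/commeq_catl/commeq_right.
by exists (a ++ b), c, z, z; left; rewrite -catA.
Qed.

(** If y is the only noncommuting letter in between, the others can be moved away,
    which leaves a factor zyz. *)
Lemma fcword_gap1 a z b y d c : fcword m (a ++ z :: b ++ y :: d ++ z :: c) ->
  (forall x, x \in b -> m z x = 2) -> (forall x, x \in d -> m z x = 2) ->
  m z y <> 3.
Proof.
move=> fw zb zd zy; apply: (fw (a ++ b ++ [:: z, y, z & d ++ c])).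
  apply: commeq_catl; apply: commeq_trans (commeq_right _ zb) _.
  by apply: commeq_catl; do 2 apply: commeq_cons; exact: commeq_left.
by exists (a ++ b), (d ++ c), z, y; right; rewrite zy -catA.
Qed.

(** A factor stst spread over the word, when the letters in between can be moved
    away. *)
Lemma fcword_gap4 a s b1 t b2 b3 c : m s t = 4 ->
  fcword m (a ++ s :: b1 ++ t :: b2 ++ s :: b3 ++ t :: c) ->
  (forall x, x \in b1 -> m s x = 2) -> (forall x, x \in b2 -> m s x = 2) ->
  (forall x, x \in b2 -> m t x = 2) -> (forall x, x \in b3 -> m t x = 2) -> False.
Proof.
move=> st fw s1 s2 t2 t3; apply: (fw (a ++ b1 ++ b2 ++ [:: s, t, s, t & b3 ++ c])).
  apply: commeq_catl; apply: commeq_trans (commeq_right _ s1) _; apply: commeq_catl.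
  apply: (@commeq_trans _ _ _ (s :: b2 ++ t :: s :: b3 ++ t :: c)).
    by apply: commeq_cons; exact: commeq_right.
  apply: commeq_trans (commeq_right _ s2) _; apply: commeq_catl.
  by do 3 apply: commeq_cons; exact: commeq_left.
by exists (a ++ b1 ++ b2), (b3 ++ c), s, t; right; rewrite st -!catA.
Qed.

Lemma fcword_gap_laced a z b c : (forall y, y \in b -> 0 < m z y <= 3) ->
  fcword m (a ++ z :: b ++ z :: c) -> z \notin b ->
  1 < count (fun y => m z y != 2) b.
Proof.
move=> m3 fw zb; have [y yb zy] := fcword_gap fw.
rewrite ltnNge; apply/negP => c1; case/split_first: (yb) => b1 [b2 [eb _]].
move: c1; rewrite eb count_cat /=; move/eqP: (zy) => -> /=.
case/sum_le1 => e1 e2.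
have comm d : count (fun y => m z y != 2) d = 0 -> forall x, x \in d -> m z x = 2.
  move=> d0 x xd; apply/eqP; rewrite -[_ == _]negbK; apply/negP => zx.
  have : has (fun y => m z y != 2) d by apply/hasP; exists x.
  by rewrite has_count d0.
rewrite eb -catA in fw; have := fcword_gap1 fw (comm _ e1) (comm _ e2).
have zy1 : m z y <> 1.
  by apply: cox_off => ezy; move: zb; rewrite ezy yb.
have := m3 y yb; case: (m z y) zy zy1 => [|[|[|[|]]]] //.
Qed.

End Gaps.

Section Geometric.
Local Open Scope ring_scope.
Variables (S : choiceType) (m : coxmatrix S) (a : S -> S -> int).
Hypothesis a_diag : forall s, a s s = 2.
Hypothesis a_off : forall s t, s <> t ->
  [\/ [/\ m s t = 2%N, a s t = 0 & a t s = 0],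
      [/\ m s t = 3%N, a s t = -1 & a t s = -1],
      [/\ m s t = 4%N, a s t = -1 & a t s = -2] |
      [/\ m s t = 4%N, a s t = -2 & a t s = -1]].

(** The contragredient of the geometric representation, with integral Cartan
    matrix a: a vector is given by its values on the simple roots. *)
Definition act (s : S) (f : S -> int) : S -> int := fun x => f x - a s x * f s.

Definition actw (u : seq S) (f : S -> int) : S -> int := foldr act f u.

Lemma actw_cat u v f : actw (u ++ v) f = actw u (actw v f).
Proof. by rewrite /actw foldr_cat. Qed.

Lemma act_rel s t f x : actw (stpow (m s t) s t) f x = f x.
Proof.
have [->|st] := pselect (s = t).
  by rewrite cox_diag /= /act !a_diag; ring.
by case: (a_off st) => -[-> e1 e2]; rewrite /= /act e1 e2 !a_diag; ring.
Qed.

Lemma actw_coxeq u v : coxeq m u v -> forall f, actw u f = actw v f.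
Proof.
elim=> {u v} [//|u v _ h f|u v w _ h _ h' f|u v s t f]; first by rewrite h.
  by rewrite h h'.
rewrite !actw_cat; congr actw; apply/funext => x; exact: act_rel.
Qed.

(** The vector that is 1 on all simple roots lies inside the fundamental chamber,
    so that (st)^i fixes it only if (st)^i = 1 in the dihedral group of order
    2m(s,t): it is enough to follow its coordinates at s and t. *)
Lemma crystallographic_exact s t : s <> t ->
  forall i, (0 < i < m s t)%N -> ~ coxeq m (stpow i s t) [::].
Proof.
move=> st i im /actw_coxeq/(_ (fun=> 1)) /= h.
move: (congr1 (@^~ s) h) (congr1 (@^~ t) h) im => /=.
by case: (a_off st) => -[-> e1 e2]; case: i {h} => [//|[|[|[|i]]]] //=;
  rewrite /act e1 e2 !a_diag.
Qed.

Lemma crystallographic_gt0 s t : (0 < m s t)%N.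
Proof.
have [->|st] := pselect (s = t); first by rewrite cox_diag.
by case: (a_off st) => -[->].
Qed.
End Geometric.

(** Counting principle: R u c says that the word u is encoded by c. When codes
    are commutation invariants that tell commutation classes apart, and the
    encoded words are those without forbidden factors, the fully commutative
    elements correspond to the codes. *)
Section Count.
Local Open Scope ring_scope.
Variables (S : choiceType) (m : coxmatrix S).
Hypothesis m_gt0 : forall s t, (0 < m s t)%N.
Hypothesis m_exact : forall s t, s <> t ->
  forall i, (0 < i < m s t)%N -> ~ coxeq m (stpow i s t) [::].
Variables (C : choiceType) (L : seq C) (wt : C -> nat) (R : seq S -> C -> Prop).
Hypothesis L_uniq : uniq L.
Hypothesis R_commeq : forall u v c, commeq m u v -> R u c -> R v c.
Hypothesis R_total : forall u, fcword m u -> exists2 c, c \in L & R u c.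
Hypothesis R_onto : forall c, c \in L -> exists u, R u c.
Hypothesis R_allowed : forall u c, c \in L -> R u c -> ~ forbidden m u.
Hypothesis R_inj : forall u v c, c \in L -> R u c -> R v c -> commeq m u v.
Hypothesis R_fun : forall u c d, c \in L -> d \in L -> R u c -> R u d -> c = d.
Hypothesis R_size : forall u c, c \in L -> R u c -> size u = wt c.

Lemma FCpoly_codes : FCpoly m = \sum_(c <- L) 'X^(wt c).
Proof.
pose wd c : seq S := xget [::] [set u | R u c].
have wdR c : c \in L -> R (wd c) c.
  move=> /R_onto[u uc]; exact: (@xgetI _ [::] [set u | R u c] u uc).
have fcR u c : c \in L -> R u c -> fcword m u.
  by move=> cL uc v uv; apply: (R_allowed cL); exact: R_commeq uv uc.
pose h c := coxpi m (wd c).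
rewrite /FCpoly (@reindex_fsbig _ _ _ _ _ h [set` L]); last first.
  split.
  - by move=> c /= cL; have [] := fcword_fc m_gt0 m_exact (fcR _ _ cL (wdR _ cL)).
  - move=> c d; rewrite !inE /= => cL dL /coxpiP e.
    have [rc _] := fcword_reduced m_gt0 m_exact (fcR _ _ cL (wdR _ cL)).
    have [rd hd] := fcword_reduced m_gt0 m_exact (fcR _ _ dL (wdR _ dL)).
    have := hd _ rc (coxeq_sym e) => /R_commeq/(_ (wdR _ dL)) => h'.
    exact: R_fun (wdR _ cL) h'.
  - move=> x /= fcx; have [u [xu ru lu]] := cox_lenP m (repr x).
    have ux : coxpi m u = x by rewrite -[RHS]coxpi_repr; apply/coxpiP/coxeq_sym.
    have fu : fcword m u by apply: fc_fcword => //; rewrite ux.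
    have [c cL uc] := R_total fu; exists c => //.
    rewrite -ux; apply/coxpiP/commeq_coxeq; exact: R_inj cL (wdR _ cL) uc.
rewrite (eq_fsbigr (fun c => 'X^(wt c))); last first.
  move=> c; rewrite inE /= => cL; congr ('X^ _).
  have [_ ->] := fcword_fc m_gt0 m_exact (fcR _ _ cL (wdR _ cL)).
  by apply: R_size => //; exact: wdR.
by rewrite -fsbig_seq.
Qed.
End Count.

(** * Walks and their generating series *)

(** The flag [star] forbids the label R at height 0. *)
Definition step_ok (star : bool) (h : nat) (s : step) : bool :=
  match s with
  | Up | HorL => true
  | Down => 0 < h
  | HorR => star ==> (0 < h)
  end.

Definition advance (h : nat) (s : step) : nat :=
  match s with Up => h.+1 | Down => h.-1 | HorL | HorR => h end.

Fixpoint walk_ok star h (p : seq step) : bool :=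
  if p is s :: p' then step_ok star h s && walk_ok star (advance h s) p'
  else h == 0.

Definition height h (p : seq step) i := foldl advance h (take i p).

Fixpoint area h (p : seq step) : nat :=
  if p is s :: p' then h + area (advance h s) p' else h.

Fixpoint walks star n h : seq (seq step) :=
  if n is n'.+1 then
    [seq s :: p | s <- [seq s <- [:: Up; Down; HorL; HorR] | step_ok star h s],
                  p <- walks star n' (advance h s)]
  else if h == 0 then [:: [::]] else [::].

Lemma mem_walks star n h p :
  (p \in walks star n h) = (size p == n) && walk_ok star h p.
Proof.
elim: n h p => [|n IH] h p.
  by case: p => [|s p] /=; case: eqP => // ->; rewrite inE.
apply/allpairsPdep/idP => [[s [p' [+ + ->]]]|].
  by rewrite mem_filter IH => /andP[sok _] /andP[/eqP <-] /=; rewrite eqxx sok.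
case: p => [|s p] //=; rewrite eqSS => /andP[sz /andP[sok pok]].
exists s, p; split=> //; last by rewrite IH sz.
by case: s sok {pok} => /= [_|->|_|->]; do ?case: ifP.
Qed.

Lemma uniq_walks star n h : uniq (walks star n h).
Proof.
elim: n h => [|n IH] h; first by rewrite /=; case: ifP.
apply: allpairs_uniq_dep => [|s _|]; first exact: filter_uniq.
  exact: IH.
by move=> [s p] [s' p'] _ _ /= [-> ->].
Qed.

Lemma height0 h p : height h p 0 = h.
Proof. by rewrite /height take0. Qed.

Lemma height_cons h s p i : height h (s :: p) i.+1 = height (advance h s) p i.
Proof. by []. Qed.

Lemma heightS h p i : i < size p ->
  height h p i.+1 = advance (height h p i) (nth Up p i).
Proof. by move=> ip; rewrite /height (take_nth Up) // foldl_rcons. Qed.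

Lemma walk_ok_step star h p i : walk_ok star h p -> i < size p ->
  step_ok star (height h p i) (nth Up p i).
Proof.
elim: p h i => //= s p IH h [|i] /andP[sok pok] ip; first by rewrite height0.
by rewrite height_cons; exact: IH.
Qed.

Lemma walk_ok_end star h p : walk_ok star h p -> height h p (size p) = 0.
Proof.
elim: p h => [|s p IH] h /=; first by move/eqP->.
by case/andP=> _ /IH.
Qed.

Lemma areaE h p : area h p = \sum_(0 <= i < (size p).+1) height h p i.
Proof.
elim: p h => [|s p IH] h /=; first by rewrite big_nat1 height0.
by rewrite big_nat_recl // height0 IH.
Qed.

Lemma walk_ok_le star h p : walk_ok star h p -> h <= size p.
Proof.
elim: p h => [|s p IH] h /=; first by move/eqP->.
by case/andP=> _ /IH; case: s => /=; lia.
Qed.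

Section WalkSeries.
Local Open Scope ring_scope.

Definition walk_poly star n h : {poly int} := \sum_(p <- walks star n h) 'X^(area h p).

Lemma walk_poly0 star h : walk_poly star 0 h = (h == 0%N)%:R.
Proof.
rewrite /walk_poly /=; case: eqP => [->|_]; last by rewrite big_nil.
by rewrite big_seq1 expr0.
Qed.

Lemma walk_polyS star n h : walk_poly star n.+1 h = 'X^h *
  (walk_poly star n h.+1 + (if h is h'.+1 then walk_poly star n h' else 0) +
    walk_poly star n h
   + (if step_ok star h HorR then walk_poly star n h else 0)).
Proof.
rewrite {1}/walk_poly big_allpairs_dep big_filter !big_mkcond /= !big_cons big_nil.
have E k : \sum_(p <- walks star n k) 'X^(h + area k p) =
  'X^h * walk_poly star n k :> {poly int}.
  by rewrite big_distrr; apply: eq_bigr => p _; rewrite exprD.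
rewrite /= !E; case: h {E} => [|h] /=; rewrite ?implybT ?implybF /=.
  by case: star => /=; ring.
by ring.
Qed.

(** First passage to height 0: a walk from height h + 1 > 0 stays at positive
    height, where it is a walk from h moved up by one, until its first step down
    to the axis. *)
Lemma first_passage n h : walk_poly true n h.+1 =
  \sum_(k < n) 'X^(k.+1) * walk_poly false k h * walk_poly true (n - k.+1) 0.
Proof.
elim: n h => [|n IH] h; first by rewrite big_ord0 walk_poly0.
pose F j : {poly int} :=
  \sum_(k < n) 'X^(k.+1) * walk_poly false k j * walk_poly true (n - k.+1) 0.
have step : \sum_(k < n) 'X^(k.+2) * walk_poly false k.+1 h * walk_poly true (n.+1 - k.+2) 0 =
    'X^(h.+1) * (F h.+1 + (if h is h'.+1 then F h' else 0) + F h + F h).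
  rewrite /F; case: h => [|h]; rewrite ?addr0 -!big_split /= big_distrr /=;
    by apply: eq_bigr => k _; rewrite walk_polyS subSS /= !exprS; ring.
rewrite big_ord_recl /= /bump /= subn1 /= walk_poly0 walk_polyS /=.
rewrite IH (IH h) -/(F h) -/(F h.+1).
rewrite step; case: h {step} => [|h] /=; last by rewrite (IH h) -/(F h); ring.
by ring.
Qed.

Definition walk_code n (P : prewalk n) : nat * seq step := (wheight P 0, val P.2).

Lemma is_walkE n (P : prewalk n) : is_walk P ->
  forall i, (i <= n)%N -> wheight P i = height (wheight P 0) (val P.2) i.
Proof.
move=> wP; elim=> [|i IH] ni; first by rewrite height0.
rewrite heightS ?size_tuple // -IH ?(ltnW ni) //.
have := wP (Ordinal ni); rewrite (tnth_nth Up) /=.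
by case: (nth Up _ _) => /= ->.
Qed.

Lemma walk_okP star h p :
  (forall i, (i < size p)%N -> step_ok star (height h p i) (nth Up p i)) ->
  height h p (size p) = 0%N -> walk_ok star h p.
Proof.
elim: p h => [|s p IH] h /= hp h0; first by rewrite -h0.
by rewrite (hp 0%N) // IH // => i ip; exact: (hp i.+1).
Qed.

Lemma walk_codeP n (P : prewalk n) (star : bool) : Qwalks P -> (star -> allL P) ->
  walk_ok star (wheight P 0) (val P.2).
Proof.
move=> [wP e0] aP; apply: walk_okP => [i|]; rewrite size_tuple; last first.
  by rewrite -is_walkE.
move=> ni; rewrite -is_walkE ?(ltnW ni) //.
have := wP (Ordinal ni); rewrite (tnth_nth Up) /=.
case e: (nth Up _ _) => //=; first by move->.
move=> _.
apply/implyP => /aP/(_ (Ordinal ni)); rewrite (tnth_nth Up) /= e lt0n => h.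
by apply/eqP => /h.
Qed.

Lemma ht_area n (P : prewalk n) : is_walk P -> ht P = area (wheight P 0) (val P.2).
Proof.
move=> wP; rewrite areaE /ht size_tuple; apply: eq_big_nat => i /andP[_].
by rewrite ltnS => /(is_walkE wP).
Qed.

Lemma walk_code_inj n (P P' : prewalk n) : is_walk P -> is_walk P' ->
  walk_code P = walk_code P' -> P = P'.
Proof.
move=> wP wP' [h0 ep]; have := is_walkE wP; have := is_walkE wP'.
have {}ep : val P.2 = val P'.2 by [].
rewrite h0 ep; case: P P' ep {wP wP' h0} => [hs p] [hs' p'] /= /val_inj -> h h'.
congr pair; apply: val_inj; apply: (@eq_from_nth _ 0%N); rewrite ?size_tuple //.
by move=> i ni; rewrite [LHS]h' ?[RHS]h.
Qed.

Lemma walk_code_surj n star h p : size p = n -> walk_ok star h p ->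
  exists P : prewalk n, [/\ Qwalks P, star -> allL P & walk_code P = (h, p)].
Proof.
move=> /eqP sz pok; pose t : n.-tuple step := Tuple sz.
pose hs : n.+1.-tuple nat := [tuple height h p i | i < n.+1].
have hsE i : (i <= n)%N -> wheight (hs, t) i = height h p i.
  rewrite -ltnS => ni; rewrite /wheight -[i]/(val (Ordinal ni)).
  by rewrite -[LHS]tnth_nth tnth_mktuple.
exists (hs, t); split; first split.
- move=> i; have ni := ltn_ord i; rewrite !hsE ?(ltnW ni) // (tnth_nth Up).
  have ni' : (i < size p)%N by rewrite (eqP sz).
  rewrite heightS //; have := walk_ok_step pok ni'.
  rewrite -[val (hs, t).2]/p.
  by case: (nth Up p i) => //=; case: (height _ _ _).
- by rewrite hsE // -(eqP sz); exact: walk_ok_end pok.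
- move=> st i; have ni := ltn_ord i; rewrite hsE ?(ltnW ni) // (tnth_nth Up).
  have ni' : (i < size p)%N by rewrite (eqP sz).
  rewrite -[val (hs, t).2]/p.
  by have := walk_ok_step pok ni'; case: (nth Up p i) => //=;
    rewrite st => /= + h0; rewrite h0.
- by rewrite /walk_code hsE // height0.
Qed.

Local Open Scope classical_set_scope.

(** The heights of a walk follow from its first height and its steps. *)
Lemma sum_walks n (star : bool) (hs : seq nat) (A : set (prewalk n)) : uniq hs ->
  (forall P, A P <-> [/\ Qwalks P, star -> allL P & wheight P 0 \in hs]) ->
  \sum_(P \in A) ('X^(ht P) : {poly int}) = \sum_(h <- hs) walk_poly star n h.
Proof.
move=> uhs AE.
pose codes := [seq (h, p) | h <- hs, p <- walks star n h].
have ucodes : uniq codes.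
  apply: allpairs_uniq_dep => // [h _|]; first exact: uniq_walks.
  by move=> [s p] [s' p'] _ _ /= [-> ->].
have -> : \sum_(h <- hs) walk_poly star n h = \sum_(c <- codes) 'X^(area c.1 c.2).
  by rewrite big_allpairs_dep.
rewrite [RHS]fsbig_seq // (@reindex_fsbig _ _ _ _ _ (@walk_code n) A); last first.
  split.
  - move=> P /AE[QP aP hP] /=; apply/allpairsPdep.
    exists (wheight P 0), (val P.2); split=> //.
    by rewrite mem_walks size_tuple eqxx walk_codeP.
  - move=> P P'; rewrite !inE => /AE[[wP _] _ _] /AE[[wP' _] _ _].
    exact: walk_code_inj.
  - move=> c /= /allpairsPdep[h [p [hhs + ->]]].
    rewrite mem_walks => /andP[/eqP sz pok].
    have [P [QP aP eP]] := walk_code_surj sz pok.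
    by exists P => //; apply/AE; split=> //; case: eP => ->.
apply: eq_fsbigr => P; rewrite inE => /AE[[wP _] _ _].
by rewrite (ht_area wP).
Qed.

Lemma fcoef_Mx n : fcoef Mx n = walk_poly false n 0.
Proof.
rewrite /= (@sum_walks _ false [:: 0%N]) ?big_seq1 // => P; rewrite inE.
by split=> [[? ->]|[? _ /eqP]].
Qed.

Lemma fcoef_Mstarx n : fcoef Mstarx n = walk_poly true n 0.
Proof.
rewrite /= (@sum_walks _ true [:: 0%N]) ?big_seq1 // => P; rewrite inE.
split=> [[[? ->] ?]|[? h /eqP]]; first by split.
by split; [split|exact: h].
Qed.

Lemma fcoef_Qstarx n : fcoef Qstarx n = \sum_(0 <= h < n.+1) walk_poly true n h.
Proof.
rewrite /= (@sum_walks _ true (iota 0 n.+1)) ?iota_uniq //.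
move=> P; rewrite mem_iota add0n leq0n /= ltnS.
split=> [[QP aP]|[QP aP _]]; last by split=> //; exact: aP.
split=> //; have := walk_ok_le (walk_codeP QP (fun _ : true => aP)).
by rewrite size_tuple.
Qed.

Lemma fcoefC (a : {poly int}) (f : fps {poly int}) n :
  fcoef (fpsC a * f) n = a * fcoef f n.
Proof.
by rewrite fcoefM big_ord_recl subn0 big1 ?addr0 // => i _; rewrite mul0r.
Qed.

Lemma fcoef_sxS (f : fps {poly int}) n : fcoef (sx * f) n.+1 = fcoef f n.
Proof.
rewrite fcoefM !big_ord_recl mul0r add0r mul1r subn1 big1 ?addr0 // => i _.
by rewrite mul0r.
Qed.

Lemma fcoef_sx0 (f : fps {poly int}) : fcoef (sx * f) 0 = 0.
Proof. by rewrite fcoefM big_ord1 mul0r. Qed.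

Definition geom : fps {poly int} := Fps (fun n => 'X^(2 * n)).

Lemma geomE : (1 - sx * sq ^+ 2)^-1 = geom.
Proof.
suff e : geom * (1 - sx * sq ^+ 2) = 1.
  by apply: (mulIr unit_1_sub_xq2); rewrite e mulVr // unit_1_sub_xq2.
rewrite mulrBr mulr1 mulrC -mulrA; apply/fpsP => -[|n].
  by rewrite fcoefD fcoefN fcoef_sx0 /= subr0 expr0.
rewrite fcoefD fcoefN fcoef_sxS expr2 -mulrA !fcoefC /= mulrA -expr2 -exprD.
by rewrite mulnS subrr.
Qed.

Definition passage : fps {poly int} := Fps (fun n => walk_poly true n 1).

Lemma passageE : passage = sx * sq * Mstarx * fps_dilate 'X Mx.
Proof.
rewrite -!mulrA; apply/fpsP => -[|n]; first by rewrite fcoef_sx0 /= walk_poly0.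
rewrite fcoef_sxS fcoefC (mulrC Mstarx) fcoefM big_distrr [LHS]first_passage.
apply: eq_bigr => k _; rewrite subSS -fcoef_Mx -fcoef_Mstarx exprS.
by rewrite -!mulrA.
Qed.

Lemma fcoef_geom_passage n :
  fcoef (geom * passage) n = \sum_(0 <= j < n.+1) 'X^(2 * j) * walk_poly true (n - j) 1.
Proof. by rewrite fcoefM big_mkord. Qed.

Lemma fcoef_B_peaks n : (0 < n)%N ->
  fcoef (sx ^+ 2 * sq ^+ 3 / (1 - sx * sq ^+ 2) * Mstarx * fps_dilate 'X Mx) n
  = \sum_(1 <= j < n) 'X^(2 * j) * walk_poly true (n - j) 1.
Proof.
move=> n0; have -> : sx ^+ 2 * sq ^+ 3 / (1 - sx * sq ^+ 2) * Mstarx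
    * fps_dilate 'X Mx = geom * passage - passage.
  have U : (1 - sx * sq ^+ 2) * geom = 1 by rewrite -geomE mulrV // unit_1_sub_xq2.
  rewrite passageE geomE -{2}[sx * sq * Mstarx * _]mul1r -U; ring.
rewrite fcoefD fcoefN fcoef_geom_passage big_nat_recl // muln0 expr0 mul1r subn0.
rewrite [fcoef passage n]/= addrC addKr.
rewrite -(big_add1 _ _ 0%N n.+1 xpredT
  (fun j => 'X^(2 * j) * walk_poly true (n - j) 1)).
rewrite big_nat_recr //= subnn walk_poly0 mulr0 addr0 //.
Qed.

Lemma fcoef_D_blocks n : (0 < n)%N ->
  fcoef (sx * sq ^+ 2 / (1 - sx * sq ^+ 2) * Mstarx * fps_dilate 'X Mx) n
  = \sum_(0 <= j < n) 'X^((2 * j).+1) * walk_poly true (n - j) 1.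
Proof.
move=> n0; have -> : sx * sq ^+ 2 / (1 - sx * sq ^+ 2) * Mstarx
    * fps_dilate 'X Mx = sq * (geom * passage).
  rewrite passageE geomE; ring.
rewrite fcoefC fcoef_geom_passage big_nat_recr //= subnn walk_poly0 mulr0 addr0.
by rewrite big_distrr; apply: eq_bigr => j _; rewrite exprS -mulrA.
Qed.

End WalkSeries.

(** * Words encoded by walks *)

(** The alternating word in the letters i and i + 1 with h letters i, and as many
    letters i + 1 as the height that the step s leads to. When these numbers
    agree, L means that i comes first. *)
Definition edge i h s : seq nat :=
  match s with
  | Up => altw h.*2.+1 i.+1 i
  | Down => altw h.*2.-1 i i.+1
  | HorL => altw h.*2 i i.+1
  | HorR => altw h.*2 i.+1 i
  end.

(** [edge i 1 s] with its only letter i doubled: the two ends i of a chain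
    i ... 1 0 1 ... i play the role of a single letter. *)
Definition peak_edge i s : seq nat :=
  match s with
  | Up => [:: i.+1; i; i; i.+1]
  | Down => [:: i; i]
  | HorL => [:: i; i; i.+1]
  | HorR => [:: i.+1; i; i]
  end.

(** A code (j, h, p) stands for a chain of index j, or for no chain if j = 0,
    followed by the alternating word of the walk p from the point (j, h). Below j
    the projections of a chain are 1 0 1 and i+1 i i i+1, those of a step up from
    height 1. *)
Definition code_step j p i := if i < j then Up else nth Up p (i - j).

Definition code_edge j h p i :=
  if 0 < i <= j then peak_edge i (code_step j p i)
  else edge i (height h p (i - j)) (code_step j p i).

Definition code_ok n j h p :=
  [&& size p == n - j, walk_ok true h p, j < n & (0 < j) ==> (h == 1)].

Definition proj i : seq nat -> seq nat := filter (pred2 i i.+1).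

Definition realizes n j h p v :=
  all (fun i => i < n) v /\ forall i, i < n -> proj i v = code_edge j h p i.

Lemma neqS i : i != i.+1. Proof. by rewrite neq_ltn ltnSn. Qed.
Lemma Sneq i : i.+1 != i. Proof. by rewrite eq_sym neqS. Qed.

Lemma alternating_edge i h s : alternating (edge i h s).
Proof. by case: s; apply: alternating_altw; rewrite ?neqS ?Sneq. Qed.

Lemma step_ok_weaken star h s : step_ok star h s -> step_ok false h s.
Proof. by case: s. Qed.

Lemma count_edge_l i h s : step_ok false h s -> count_mem i (edge i h s) = h.
Proof.
case: s.
- by rewrite count_altw_tail ?Sneq //= uphalf_double.
- by case: h => // h _; rewrite count_altw_head ?neqS //= doubleK.
- by rewrite count_altw_head ?neqS // uphalf_double.
- by rewrite count_altw_tail ?Sneq // doubleK.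
Qed.

Lemma count_edge_r i h s : step_ok false h s ->
  count_mem i.+1 (edge i h s) = advance h s.
Proof.
case: s.
- by rewrite count_altw_head ?Sneq //= doubleK.
- by case: h => // h _; rewrite count_altw_tail ?neqS //= uphalf_double.
- by rewrite count_altw_tail ?neqS // doubleK.
- by rewrite count_altw_head ?Sneq // uphalf_double.
Qed.

Lemma count_peak_l i s : count_mem i (peak_edge i s) = 2.
Proof. by case: s => /=; rewrite ?eqxx ?(negbTE (Sneq i)). Qed.

Lemma count_peak_r i s : count_mem i.+1 (peak_edge i s) = advance 1 s.
Proof. by case: s => /=; rewrite ?eqxx ?(negbTE (neqS i)). Qed.

Lemma edge_sub i h s x : x \in edge i h s -> (x == i) || (x == i.+1).
Proof.
have H k a b : x \in altw k a b -> (x == a) || (x == b).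
  elim: k a b => //= k IH a b; rewrite inE => /orP[->//|/IH].
  by rewrite orbC.
by case: s => /H //; rewrite orbC.
Qed.

Lemma peak_sub i s x : x \in peak_edge i s -> (x == i) || (x == i.+1).
Proof. by case: s; rewrite !inE; case: (x == i); case: (x == i.+1). Qed.

Section Code.
Variables (n j h : nat) (p : seq step).
Hypothesis ok : code_ok n j h p.
Local Notation E := (code_edge j h p).
Local Notation H i := (height h p (i - j)).
Local Notation T i := (code_step j p i).

Lemma size_code : size p = n - j. Proof. by case/and4P: ok => /eqP. Qed.
Lemma code_walk : walk_ok true h p. Proof. by case/and4P: ok. Qed.
Lemma code_lt : j < n. Proof. by case/and4P: ok. Qed.

Lemma code_peak_height : 0 < j -> h = 1.
Proof. by case/and4P: ok => _ _ _ /implyP e /e/eqP. Qed.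

Lemma code_heightS i : i < n -> H i.+1 = if i < j then H i else advance (H i) (T i).
Proof.
move=> ni; rewrite /code_step; case: ltnP => ij.
  by have [-> ->] : i.+1 - j = 0 /\ i - j = 0 by lia.
by rewrite subSn // heightS // size_code; have := code_lt; lia.
Qed.

Lemma code_step_ok i : i < n -> step_ok true (H i) (T i).
Proof.
move=> ni; rewrite /code_step; case: ltnP => // ij.
by apply: walk_ok_step code_walk _; rewrite size_code; have := code_lt; lia.
Qed.

Lemma code_height_end : H n = 0.
Proof. by rewrite -size_code; exact: walk_ok_end code_walk. Qed.

Lemma code_height_peak i : 0 < i <= j -> H i = 1.
Proof.
move=> /andP[i0 ij]; have -> : i - j = 0 by lia.
by rewrite height0 code_peak_height // (leq_trans i0).
Qed.

Lemma count_code_l i : i < n -> count_mem i (E i) = H i * (1 + (0 < i <= j)).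
Proof.
move=> ni; rewrite /code_edge; case: ifP => ij; last first.
  by rewrite count_edge_l ?muln1 //; apply: step_ok_weaken; exact: code_step_ok.
by rewrite count_peak_l (code_height_peak ij).
Qed.

Lemma count_code_r i : i < n -> count_mem i.+1 (E i) = H i.+1 * (1 + (0 < i.+1 <= j)).
Proof.
move=> ni; rewrite (code_heightS ni) ltnS leq0n /=.
have -> : count_mem i.+1 (E i) = advance (H i) (T i).
  rewrite /code_edge; case: ifP => ij.
    by rewrite count_peak_r (code_height_peak ij).
  by rewrite count_edge_r //; apply: step_ok_weaken; exact: code_step_ok.
rewrite /code_step; case: ltnP => ij; last by rewrite muln1.
have -> : i - j = 0 by lia.
by rewrite height0 code_peak_height // (leq_ltn_trans _ ij).
Qed.

Lemma code_edge_sub i x : x \in E i -> (x == i) || (x == i.+1).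
Proof. by rewrite /code_edge; case: ifP => _; [exact: peak_sub|exact: edge_sub]. Qed.

Lemma proj_filter i (P : pred nat) v : P i -> P i.+1 -> proj i (filter P v) = proj i v.
Proof.
move=> Pi PSi; rewrite /proj -filter_predI; apply: eq_filter => x /=.
by case: pred2P => //= -[->|->]; rewrite ?Pi ?PSi.
Qed.

(** Letters are added one at a time along the path: the counts in consecutive
    projections agree because p is a walk. *)
Lemma realizes_ex : exists v, realizes n j h p v.
Proof.
suff /(_ n (leqnn n)) [v [vn vp vc]] : forall k, k <= n -> exists v,
    [/\ all (fun i => i <= k) v, forall i, i < k -> proj i v = E i &
        count_mem k v = H k * (1 + (0 < k <= j))].
  exists v; split=> //; apply/allP => i iv; have := allP vn i iv.
  rewrite leq_eqVlt => /orP[/eqP ein|//]; move: vc; rewrite code_height_end mul0n.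
  by move/count_memPn; rewrite -ein iv.
elim=> [_|k IH kn].
  exists (nseq (H 0) 0); split=> //; first by apply/allP => i /nseqP[->].
  by rewrite count_nseq /= mul1n muln1.
have [v [vk vp vc]] := IH (ltnW kn).
have kv : k.+1 \notin v by apply/negP => /(allP vk); rewrite ltnn.
have [||w [w1 w2 w3]] := @glue _ k.+1 k v (E k) (Sneq k) kv.
- exact: code_edge_sub.
- by rewrite count_code_l // vc.
exists w; split.
- by apply/allP => x /w3; rewrite inE => /predU1P[->//|/(allP vk)/leqW].
- move=> i; rewrite ltnS leq_eqVlt => /predU1P[->//|ik].
  by rewrite -vp // -w1 proj_filter //= neq_ltn; apply/orP; left; lia.
- by rewrite -count_code_r // -w2 count_mem_filter //= eqxx orbT.
Qed.

Lemma count_proj_l i v : count_mem i (proj i v) = count_mem i v.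
Proof. by apply: count_mem_filter; rewrite /= eqxx. Qed.

Lemma count_proj_r i v : count_mem i.+1 (proj i v) = count_mem i.+1 v.
Proof. by apply: count_mem_filter; rewrite /= eqxx orbT. Qed.

Lemma size_count k (v : seq nat) : all (fun i => i < k) v ->
  size v = \sum_(0 <= i < k) count_mem i v.
Proof.
elim: v => [_|x v IH /= /andP[xk /IH ->]]; first by rewrite big1.
rewrite big_split /= -add1n; congr (_ + _); rewrite big_mkord.
rewrite (bigD1 (Ordinal xk)) //= eqxx big1 // => i; rewrite -val_eqE /= eq_sym.
by move/negbTE->.
Qed.

(** The letter 0 and the letters i < j of a chain account for 2j - 1 letters, and
    the doubled letter j for one letter more than the height at j. *)
Lemma realizes_size v : realizes n j h p v -> size v = 2 * j + area h p.
Proof.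
case=> vn vp; rewrite (size_count vn).
have -> : \sum_(0 <= i < n) count_mem i v = \sum_(0 <= i < n) (H i + (0 < i <= j)).
  apply: eq_big_nat => i /andP[_ ni]; rewrite -count_proj_l vp // count_code_l //.
  case: (boolP (0 < i <= j)) => [/code_height_peak ->//|_].
  by rewrite muln1 addn0.
have jn := code_lt.
rewrite big_split /= [X in _ + X](_ : _ = j); last first.
  rewrite (big_cat_nat (n := 1)) //=; last by lia.
  rewrite big_nat1 add0n (big_cat_nat (n := j.+1)) //= [X in _ + X]big_nat_cond.
  rewrite [X in _ + X]big1 ?addn0; last by move=> i; lia.
  rewrite (eq_big_nat _ _ (F2 := fun=> 1)) ?sum_nat_const_nat; first by lia.
  by move=> i; rewrite ltnS => ->.
rewrite (big_cat_nat (n := j)) ?(ltnW jn) //=.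
rewrite [X in X + _ + _](_ : _ = j); last first.
  rewrite (eq_big_nat _ _ (F2 := fun=> 1)) ?sum_nat_const_nat; first by lia.
  move=> i /andP[_ ij]; have -> : i - j = 0 by lia.
  by rewrite height0 code_peak_height // (leq_ltn_trans _ ij).
rewrite areaE big_nat_recr //= (walk_ok_end code_walk) addn0 size_code.
rewrite -[X in \sum_(X <= _ < n) _]add0n big_addn.
rewrite (eq_bigr (fun i => height h p i)); last by move=> i _; rewrite addnK.
by lia.
Qed.

Lemma code_edge_no_rr i : ~~ infix [:: i.+1; i.+1] (E i).
Proof.
apply/negP; rewrite /code_edge; case: ifP => _.
  by case: (code_step j p i); rewrite /= ?eqxx ?(negbTE (Sneq i)) ?(negbTE (neqS i)).
by move/infix_alternating/(_ (alternating_edge _ _ _)); rewrite /alternating /= eqxx.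
Qed.

Lemma code_edge_no_ll i : ~~ (0 < i <= j) -> ~~ infix [:: i; i] (E i).
Proof.
move=> ij; apply/negP; rewrite /code_edge (negbTE ij).
by move/infix_alternating/(_ (alternating_edge _ _ _)); rewrite /alternating /= eqxx.
Qed.

Lemma code_edge_no_rlr i : 0 < i <= j -> ~~ infix [:: i.+1; i; i.+1] (E i).
Proof.
move=> ij; rewrite /code_edge ij.
by case: (code_step j p i); rewrite /= ?eqxx ?(negbTE (Sneq i)) ?(negbTE (neqS i)).
Qed.

(** Each of the factors excluded in the next lemmas would leave ii, i+1 i+1 or
    i+1 i i+1 in the projection onto some {i, i+1}, where the code does not have
    it. In type B_n the factors 0 1 0 and 1 0 1 are allowed, as m(t,s_1) = 4. *)
Lemma realizes_no_square v z : realizes n j h p v -> ~~ infix [:: z; z] v.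
Proof.
move=> [vn vp]; apply/negP => zv.
have zn : z < n by apply: (allP vn); have := mem_infix zv; apply; exact: mem_head.
case: z zn zv => [|z] zn /(infix_filter _) => [/(_ (pred2 0 1))|/(_ (pred2 z z.+1))].
  by rewrite -/(proj 0 _) -/(proj 0 _) vp // (negbTE (code_edge_no_ll _)).
rewrite -/(proj z _) -/(proj z _) vp ?(ltnW zn) //= eqxx orbT.
by rewrite (negbTE (code_edge_no_rr _)).
Qed.

Lemma realizes_no_braid3_up v z : realizes n j h p v -> z.+2 < n ->
  ~~ infix [:: z.+1; z.+2; z.+1] v.
Proof.
move=> [vn vp] zn; apply/negP => /(infix_filter (pred2 z z.+1)).
rewrite -/(proj z _) -/(proj z _) vp; last by lia.
rewrite /= eqxx orbT (_ : _ || _ = false); last by lia.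
by rewrite (negbTE (code_edge_no_rr _)).
Qed.

Lemma realizes_no_braid3_down v z : realizes n j h p v -> z.+2 < n ->
  ~~ infix [:: z.+2; z.+1; z.+2] v.
Proof.
move=> [vn vp] zn; apply/negP => zv.
case: (boolP (z.+2 <= j)) => zj.
  have := infix_filter (pred2 z.+1 z.+2) zv; rewrite -/(proj z.+1 _) -/(proj z.+1 _).
  rewrite vp; last by lia.
  rewrite /= !eqxx !orbT /= (negbTE (code_edge_no_rlr _)) //; lia.
have := infix_filter (pred2 z.+2 z.+3) zv; rewrite -/(proj z.+2 _) -/(proj z.+2 _).
rewrite vp // /= eqxx /= (_ : _ || _ = false); last by lia.
by rewrite (negbTE (code_edge_no_ll _)) // negb_and zj orbT.
Qed.

Lemma realizes_no_101 v : realizes n j h p v -> j = 0 -> 1 < n ->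
  ~~ infix [:: 1; 0; 1] v.
Proof.
move=> [vn vp] j0 n1; apply/negP => /(infix_filter (pred2 1 2)).
rewrite -/(proj 1 _) -/(proj 1 _) vp //= (negbTE (code_edge_no_ll _)) //.
by rewrite j0.
Qed.

Lemma realizes_count0 v : realizes n j h p v -> count_mem 0 v = h.
Proof.
move=> [vn vp]; have n0 : 0 < n := leq_ltn_trans (leq0n j) code_lt.
by rewrite -count_proj_l vp // count_code_l // sub0n height0 muln1.
Qed.

Lemma realizes_no_braid4 v : realizes n j h p v -> 1 < n ->
  ~~ infix [:: 0; 1; 0; 1] v /\ ~~ infix [:: 1; 0; 1; 0] v.
Proof.
move=> rv n1; have [j0|j0] := posnP j.
  have no := realizes_no_101 rv j0 n1; split; apply: contra no => /infixP[a [b ->]].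
    by apply/infixP; exists (a ++ [:: 0]), b; rewrite -catA.
  by apply/infixP; exists a, (0 :: b).
have := realizes_count0 rv; rewrite code_peak_height // => c; split;
  apply/negP => /infixP[a [b e]];
  by move: c; rewrite e !count_cat /=; lia.
Qed.

End Code.

Lemma edge_inj i h s s' : step_ok true h s -> step_ok true h s' ->
  edge i h s = edge i h s' -> s = s'.
Proof.
move=> ok ok' e; have := congr1 (count_mem i.+1) e.
rewrite !count_edge_r ?(step_ok_weaken ok) ?(step_ok_weaken ok') //.
case: s s' ok ok' e => -[] //=; case: h => //=; try lia.
- by move=> h _ _ [/eqP]; rewrite (negbTE (neqS _)).
- by move=> h _ _ [/eqP]; rewrite (negbTE (Sneq _)).
Qed.

Lemma peak_edge_inj i s s' : peak_edge i s = peak_edge i s' -> s = s'.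
Proof.
by case: s s' => -[] //= [] /eqP; rewrite ?(negbTE (Sneq i)) ?(negbTE (neqS i)).
Qed.

(** The index j is the largest i >= 1 such that ii is a factor of the projection
    onto {i, i+1}; the heights are counts of letters. *)
Lemma realizes_fun n j h p j' h' p' v : code_ok n j h p -> code_ok n j' h' p' ->
  realizes n j h p v -> realizes n j' h' p' v -> [/\ j = j', h = h' & p = p'].
Proof.
move=> ok ok' [vn vp] [_ vp'].
have E i : i < n -> code_edge j h p i = code_edge j' h' p' i.
  by move=> ni; rewrite -vp // vp'.
have peak_ll i s : infix [:: i; i] (peak_edge i s).
  by case: s; rewrite /= ?eqxx ?orbT.
have lt k l f g q r : code_ok n k f q -> code_ok n l g r ->
    (forall i, i < n -> code_edge k f q i = code_edge l g r i) -> ~ k < l.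
  move=> ok1 ok2 e kl; have := @code_edge_no_ll k f q l.
  rewrite e ?(code_lt ok2) // {1}/code_edge leqnn (leq_ltn_trans _ kl) //=.
  by rewrite peak_ll leqNgt kl => /(_ isT).
have ejj : j = j'.
  case: (ltngtP j j') => // jj; first by case: (lt _ _ _ _ _ _ ok ok' E).
  by case: (lt _ _ _ _ _ _ ok' ok _) => // i ni; rewrite E.
subst j'; have hE i : i < n -> height h p (i - j) = height h' p' (i - j).
  move=> ni; have := congr1 (count_mem i) (E i ni); rewrite !(@count_code_l n) //.
  by move/eqP; rewrite eqn_mul2r addn_eq0 /= => /eqP.
have jn := code_lt ok.
split=> //; first by have := hE j jn; rewrite subnn !height0.
apply: (@eq_from_nth _ Up) => [|k]; rewrite (size_code ok) ?(size_code ok') // => kn.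
have ni : j + k < n by lia.
have sE : nth Up p k = code_step j p (j + k).
  by rewrite /code_step addKn ifF //; lia.
have sE' : nth Up p' k = code_step j p' (j + k).
  by rewrite /code_step addKn ifF //; lia.
have := E _ ni; rewrite sE sE' /code_edge; case: ifP => _; first exact: peak_edge_inj.
rewrite -hE //; apply: edge_inj; first exact: (code_step_ok ok).
by rewrite hE //; exact: (code_step_ok ok').
Qed.
(** * Classification *)

Lemma alternating_is_edge i e : alternating e -> {subset e <= pred2 i i.+1} ->
  exists s, step_ok true (count_mem i e) s /\ e = edge i (count_mem i e) s.
Proof.
move=> alt sub.
suff [h [s [ok es]]] : exists h s, step_ok true h s /\ e = edge i h s.
  exists s; have -> : count_mem i e = h by rewrite es count_edge_l //;
    exact: step_ok_weaken ok.
  by [].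
have := alternatingE alt sub (neqS i); rewrite -(odd_double_half (size e)).
set k := (size e)./2; case: (odd _) => -[->|->].
- by exists k.+1, Down.
- by exists k, Up.
- by exists k, HorL.
- case: k => [|k]; first by exists 0, HorL.
  by exists k.+1, HorR.
Qed.

(** Steps chosen edge by edge form a walk once they fit a given sequence of
    heights; Q is the information to be recorded on each step. *)
Lemma walk_of_edges (H : nat -> nat) (Q : nat -> step -> Prop) j d :
  (forall i, j <= i < j + d ->
     exists s, [/\ step_ok true (H i) s, advance (H i) s = H i.+1 & Q i s]) ->
  H (j + d) = 0 ->
  exists p, [/\ size p = d, walk_ok true (H j) p &
    forall k, k < d -> height (H j) p k = H (j + k) /\ Q (j + k) (nth Up p k)].
Proof.
elim: d j => [|d IH] j hs H0.
  by exists [::]; split=> //=; rewrite -H0 addn0.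
have [|s [sok sH Qs]] := hs j; first by lia.
have [|| p [sp wp hp]] := IH j.+1; rewrite ?addSnnS //.
  by move=> i ij; apply: hs; lia.
exists (s :: p); split=> /=; rewrite ?sp ?sok ?sH //.
case=> [|k] kd; first by rewrite addn0 height0.
by rewrite height_cons sH -addSnnS; exact: hp.
Qed.

(** The necessary conditions on a fully commutative word of type B_n that drive
    its classification, with 0 for t and i for s_i: how many neighbours must
    occur between two consecutive occurrences of a letter. *)
Record gap_conditions n (v : seq nat) : Prop := GapConditions {
  gap_letters : all (fun i => i < n) v;
  gap_0 : forall a b c, v = a ++ 0 :: b ++ 0 :: c -> 0 \notin b -> 1 \in b;
  gap_1 : forall a b c, v = a ++ 1 :: b ++ 1 :: c -> 1 \notin b ->
    0 \in b \/ 1 < count_mem 2 b;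
  gap_SS : forall i a b c, v = a ++ i.+2 :: b ++ i.+2 :: c -> i.+2 \notin b ->
    1 < count_mem i.+1 b + count_mem i.+3 b;
  gap_0101 : forall a b d c, v = a ++ 0 :: b ++ 1 :: d ++ 1 :: c ->
    0 \notin b -> 1 \notin b -> 1 \notin d -> 2 \notin d -> count_mem 0 d = 1 ->
    False;
  gap_1010 : forall a b d c, v = a ++ 1 :: d ++ 1 :: b ++ 0 :: c ->
    0 \notin b -> 1 \notin b -> 1 \notin d -> 2 \notin d -> count_mem 0 d = 1 ->
    False
}.

(** Two occurrences of i + 1 inside a gap of i would need two occurrences of
    i + 2 inside a gap of i + 1, and so on beyond the last letter. *)
Lemma gap_above n v : all (fun i => i < n) v ->
  (forall i a b c, v = a ++ i.+2 :: b ++ i.+2 :: c -> i.+2 \notin b ->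
    1 < count_mem i.+1 b + count_mem i.+3 b) ->
  forall i a b c, v = a ++ i.+1 :: b ++ i.+1 :: c -> i.+1 \notin b ->
  count_mem i.+2 b <= 1.
Proof.
move=> vn gSS i a b c; have [d] := ubnP (n - i);
  elim: d i a b c => // d IH i a b c di ev ib.
rewrite leqNgt; apply/negP => /split_two[b1 [b' [b2 [eb ib']]]].
have ni : i.+1 < n.
  by apply: (allP vn); rewrite ev mem_cat mem_head orbT.
have ev' : v = (a ++ i.+1 :: b1) ++ i.+2 :: b' ++ i.+2 :: (b2 ++ i.+1 :: c).
  by rewrite ev eb -?catA /= -?catA /= -?catA.
have := gSS _ _ _ _ ev' ib'; have := IH i.+1 _ _ _ _ ev' ib'.
have -> : count_mem i.+1 b' = 0.
  apply/count_memPn; apply: contra ib => ib'2.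
  by rewrite eb mem_cat inE mem_cat ib'2 !orbT.
by move=> /(_ ltac:(lia)); lia.
Qed.

Section Classification.
Variables (n : nat) (v : seq nat).
Hypothesis gv : gap_conditions n v.

Lemma gap_below i a b c : v = a ++ i.+1 :: b ++ i.+1 :: c -> i.+1 \notin b ->
  i \in b.
Proof.
move=> ev ib; have := gap_above (gap_letters gv) (gap_SS gv) ev ib.
case: i ev ib => [|i] ev ib; first by case: (gap_1 gv ev ib) => //; lia.
by have := gap_SS gv ev ib; rewrite -has_pred1 has_count; lia.
Qed.

Lemma factor_count i x s y : v = x ++ s ++ y -> i \notin s ->
  count_mem i.+1 s <= 1.
Proof.
move=> ev si; rewrite leqNgt; apply/negP => /split_two[a [b [c [es ib]]]].
have ev' : v = (x ++ a) ++ i.+1 :: b ++ i.+1 :: (c ++ y).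
  by rewrite ev es -?catA /= -?catA.
by move: si; rewrite es !(mem_cat, inE) (gap_below ev' ib) !orbT.
Qed.

Lemma factor_count0 x s y : v = x ++ s ++ y -> 1 \notin s -> count_mem 0 s <= 1.
Proof.
move=> ev si; rewrite leqNgt; apply/negP => /split_two[a [b [c [es ib]]]].
have ev' : v = (x ++ a) ++ 0 :: b ++ 0 :: (c ++ y).
  by rewrite ev es -?catA /= -?catA.
by move: si; rewrite es !(mem_cat, inE) (gap_0 gv ev' ib) !orbT.
Qed.

(** The way in which alternation of i and i + 1 can fail. *)
Definition peak_at i := exists a b c,
  [/\ v = a ++ i :: b ++ i :: c, i \notin b & i.+1 \notin b].

Lemma alternating_of_no_peak i : i = 0 \/ ~ peak_at i -> alternating (proj i v).
Proof.
move=> ip; apply: alternating_proj => a b c ev ib; last exact: gap_below ev ib.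
case: ip ev ib => [->|np] ev ib; first exact: gap_0 gv _ _ _ ev ib.
by apply/negPn/negP => Sib; apply: np; exists a, b, c.
Qed.

(** A gap of i + 2 without i + 3 contains two letters i + 1, and these have no
    i + 2 between them. *)
Lemma peak_down i : peak_at i.+2 -> peak_at i.+1.
Proof.
move=> [a [b [c [ev ib Sib]]]]; have := gap_SS gv ev ib.
rewrite (count_memPn Sib) addn0 => /split_two[b1 [b' [b2 [eb ib']]]].
exists (a ++ i.+2 :: b1), b', (b2 ++ i.+2 :: c); split=> //.
  by rewrite ev eb -?catA /= -?catA /= -?catA.
by apply: contra ib => ib'2; rewrite eb mem_cat inE mem_cat ib'2 !orbT.
Qed.

(** What a peak turns out to be: the outer letters of a chain i ... 1 0 1 ... i,
    which are then the only letters i. *)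
Definition chain_at i := exists a b c,
  [/\ v = a ++ i :: b ++ i :: c, [/\ i \notin a, i \notin b & i \notin c]
    & i.+1 \notin b].

Lemma proj_notl i s : i \notin s -> proj i s = nseq (count_mem i.+1 s) i.+1.
Proof.
elim: s => //= x s IH; rewrite inE negb_or => /andP[ix /IH ->].
by rewrite eq_sym (negbTE ix) /=; case: eqP => [->|].
Qed.

Lemma proj_notr i s : i.+1 \notin s -> proj i s = nseq (count_mem i s) i.
Proof.
elim: s => //= x s IH; rewrite inE negb_or => /andP[ix /IH ->].
by rewrite (eq_sym x i.+1) (negbTE ix) orbF; case: eqP => [->|].
Qed.

Lemma proj_gap i a x b c : proj i (a ++ x :: b ++ x :: c) =
  proj i a ++ proj i [:: x] ++ proj i b ++ proj i [:: x] ++ proj i c.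
Proof. by rewrite /proj -(cat1s x (b ++ _)) -(cat1s x c) !filter_cat. Qed.

(** A letter 0 on a side of the factor 1 0 1 would complete it to a factor
    0 1 0 1 or 1 0 1 0, unless two letters 1 without 0 between them come first;
    then a letter 1 on a side would have no 0 to separate it from the factor. *)
Lemma chain_start : peak_at 1 -> chain_at 1 /\ proj 0 v = [:: 1; 0; 1].
Proof.
move=> [a [b [c [ev b1 b2]]]].
have b0 : count_mem 0 b = 1.
  have [|] := gap_1 gv ev b1; last by rewrite (count_memPn b2).
  rewrite -has_pred1 has_count => bpos.
  have := @factor_count0 (a ++ [:: 1]) b (1 :: c); rewrite -catA => /(_ ev b1); lia.
have a0 : 0 \notin a.
  apply/negP => /split_last[a1 [a2 [ea a20]]].
  have a21 : 1 \notin a2.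
    have := @factor_count 0 (a1 ++ [:: 0]) (a2 ++ [:: 1]) (b ++ 1 :: c).
    rewrite mem_cat negb_or a20 count_cat /= addn0 => h.
    apply/negP; rewrite -has_pred1 has_count.
    by have := h _ isT; rewrite ev ea -?catA /= -?catA /= => /(_ erefl); lia.
  apply: (gap_0101 gv (a := a1) (b := a2) (d := b) (c := c)) => //.
  by rewrite ev ea -catA.
have c0 : 0 \notin c.
  apply/negP => /split_first[c1 [c2 [ec c10]]].
  have c11 : 1 \notin c1.
    have := @factor_count 0 (a ++ 1 :: b) (1 :: c1) (0 :: c2).
    rewrite inE /= c10 => h; apply/negP; rewrite -has_pred1 has_count.
    by have := h _ isT; rewrite ev ec -?catA /= => /(_ erefl); lia.
  apply: (gap_1010 gv (a := a) (b := c1) (d := b) (c := c2)) => //.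
  by rewrite ev ec.
have a1 : 1 \notin a.
  have := @factor_count 0 [::] (a ++ [:: 1]) (b ++ 1 :: c).
  rewrite mem_cat negb_or a0 count_cat /= addn0 => h.
  apply/negP; rewrite -has_pred1 has_count.
  by have := h _ isT; rewrite ev -catA /= => /(_ erefl); lia.
have c1 : 1 \notin c.
  have := @factor_count 0 (a ++ 1 :: b) (1 :: c) [::].
  rewrite inE /= c0 cats0 => h; apply/negP; rewrite -has_pred1 has_count.
  by have := h _ isT; rewrite ev -?catA /= => /(_ erefl); lia.
split; first by exists a, b, c.
rewrite ev proj_gap.
rewrite (proj_notr a1) (proj_notr b1) (proj_notr c1) b0.
rewrite (count_memPn a0) (count_memPn c0).
by [].
Qed.

(** As i + 1 occurs only twice, both occurrences lie in the gap of i + 2; a further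
    letter i + 2 would bound a gap without i + 1. *)
Lemma chain_up i : chain_at i.+1 -> peak_at i.+2 ->
  chain_at i.+2 /\ proj i.+1 v = peak_edge i.+1 Up.
Proof.
move=> [a' [b' [c' [ev' [ia' ib' ic'] _]]]] [a [b [c [ev ib Sib]]]].
have ci : count_mem i.+1 v = 2.
  by rewrite ev' !count_cat /= count_cat /= !eqxx !(count_memPn _).
have cb := gap_SS gv ev ib; rewrite (count_memPn Sib) addn0 in cb.
rewrite {1}ev !count_cat /= count_cat /= (negbTE (Sneq _)) !add0n in ci.
have [/count_memPn ia {}cb /count_memPn ic] :
    [/\ count_mem i.+1 a = 0, count_mem i.+1 b = 2 & count_mem i.+1 c = 0].
  move: cb ci; set A := count _ a; set B := count _ b; set C := count _ c.
  by move=> cb ci; split; lia.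
have Sa : i.+2 \notin a.
  have := @factor_count i.+1 [::] (a ++ [:: i.+2]) (b ++ i.+2 :: c).
  rewrite mem_cat negb_or ia inE (negbTE (neqS _)) count_cat /= eqxx addn0 => h.
  apply/negP; rewrite -has_pred1 has_count.
  by have := h _ isT; rewrite ev -catA /= => /(_ erefl); lia.
have Sc : i.+2 \notin c.
  have := @factor_count i.+1 (a ++ i.+2 :: b) (i.+2 :: c) [::].
  rewrite inE (negbTE (neqS _)) /= ic cats0 eqxx => h.
  apply/negP; rewrite -has_pred1 has_count.
  by have := h _ isT; rewrite ev -?catA /= => /(_ erefl); lia.
split; first by exists a, b, c.
rewrite ev proj_gap.
rewrite (proj_notr Sa) (proj_notr ib) (proj_notr Sc) cb.
by rewrite (count_memPn ia) (count_memPn ic) /= eqxx orbT.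
Qed.

(** Each side of the chain contains at most one letter i + 2, because two of them
    would enclose a letter i + 1. *)
Lemma chain_end i : chain_at i.+1 -> exists s, proj i.+1 v = peak_edge i.+1 s.
Proof.
move=> [a [b [c [ev [ia ib ic] Sib]]]].
have ca := @factor_count i.+1 [::] a (i.+1 :: b ++ i.+1 :: c) ev ia.
have cc : count_mem i.+2 c <= 1.
  apply: (@factor_count i.+1 (a ++ i.+1 :: b ++ [:: i.+1]) c [::]) => //.
  by rewrite ev -?catA /= -?catA cats0.
have -> : proj i.+1 v = nseq (count_mem i.+2 a) i.+2 ++ [:: i.+1; i.+1]
    ++ nseq (count_mem i.+2 c) i.+2.
  rewrite ev proj_gap.
  rewrite (proj_notl ia) (proj_notl ic) (proj_notl ib) (count_memPn Sib).
  by rewrite /= eqxx.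
case: (count_mem _ a) ca => [|[|]] // _; case: (count_mem _ c) cc => [|[|]] // _.
- by exists Down.
- by exists HorL.
- by exists HorR.
- by exists Up.
Qed.

Lemma chain_of_peak j : peak_at j.+1 -> [/\ chain_at j.+1, proj 0 v = [:: 1; 0; 1]
  & forall i, 0 < i <= j -> proj i v = peak_edge i Up].
Proof.
elim: j => [|j IH] pj.
  by have [? ?] := chain_start pj; split=> // i; lia.
have [cj p0 pi] := IH (peak_down pj); have [cSj pSj] := chain_up cj pj.
split=> // i; rewrite (leq_eqVlt i) => /andP[i0 /predU1P[->//|ij]].
by apply: pi; rewrite i0.
Qed.

(** The largest peak is the outer end of a chain, and alternation holds everywhere
    beyond it. *)
Lemma gap_conditions_realizes : 0 < n -> exists j h p,
  [/\ code_ok n j h p, realizes n j h p v & 0 < j -> peak_at 1].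
Proof.
move=> n0.
have nn : count_mem n v = 0.
  by apply/count_memPn/negP => /(allP (gap_letters gv)); rewrite ltnn.
have sub i : {subset proj i v <= pred2 i i.+1}.
  by move=> x; rewrite mem_filter => /andP[].
have alt_step i : i = 0 \/ ~ peak_at i -> exists s,
    [/\ step_ok true (count_mem i v) s, advance (count_mem i v) s = count_mem i.+1 v
      & proj i v = edge i (count_mem i v) s].
  move=> /alternating_of_no_peak/alternating_is_edge/(_ (sub i))[s [sok es]].
  rewrite count_proj_l in sok es; exists s; split=> //.
  by rewrite -(count_proj_r i v) es count_edge_r //; exact: step_ok_weaken sok.
have [[i pi]|np] := pselect (exists i, `[< peak_at i.+1 >]); last first.
  have [||p [sp wp hp]] := @walk_of_edges (fun i => count_mem i v)
      (fun i s => proj i v = edge i (count_mem i v) s) 0 n.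
  - move=> i _; apply: alt_step; case: i => [|i]; [by left|right => pi].
    by apply: np; exists i; apply/asboolP.
  - by rewrite add0n.
  exists 0, (count_mem 0 v), p; split=> //;
    first by rewrite /code_ok subn0 sp eqxx wp n0.
  split=> [|i ni]; first exact: gap_letters gv.
  have [hpi Qi] := hp i ni; rewrite /code_edge /code_step ltn0 subn0 hpi Qi.
  by rewrite leqn0 lt0n andNb add0n.
have bnd k : `[< peak_at k.+1 >] -> k <= n.
  move=> /asboolP[a [b [c [ev _ _]]]]; apply: ltnW; apply: ltnW.
  by apply: (allP (gap_letters gv)); rewrite ev mem_cat mem_head orbT.
have [j /asboolP pj jmax] := ex_maxnP (ex_intro _ i pi) bnd.
have jn : j.+1 < n.
  case: pj => a [b [c [ev _ _]]].
  by apply: (allP (gap_letters gv)); rewrite ev mem_cat mem_head orbT.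
have [cj p0 pchain] := chain_of_peak pj.
(* The two letters j + 1 at the ends of the chain count for one. *)
pose H k := if k == j.+1 then 1 else count_mem k v.
have [||p [sp wp hp]] := @walk_of_edges H (fun i s => proj i v =
    if i == j.+1 then peak_edge i s else edge i (H i) s) j.+1 (n - j.+1).
- move=> k /andP[jk kn]; rewrite /H (_ : k.+1 == j.+1 = false); last by lia.
  case: eqP => [->|kj].
    have [s es] := chain_end cj; exists s; split=> //; first by case: (s).
    by rewrite -(count_proj_r j.+1 v) es count_peak_r.
  apply: alt_step; right => pk; case: k jk kj pk {kn} => // k jk kj pk.
  by have := jmax k ltac:(exact/asboolP); lia.
- by rewrite subnKC ?(ltnW jn) // /H (_ : n == j.+1 = false) //; lia.
have Hj : H j.+1 = 1 by rewrite /H eqxx.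
rewrite Hj in wp hp; exists j.+1, 1, p; split.
- by rewrite /code_ok sp eqxx wp jn.
- split=> [|k kn]; first exact: gap_letters gv.
  rewrite /code_edge /code_step; case: (ltngtP k j.+1) => kj.
  + rewrite andbT; case: k kj {kn} => [|k] kj /=; first by rewrite sub0n height0 p0.
    by apply: pchain; lia.
  + rewrite andbF; have [hk Qk] := hp (k - j.+1) ltac:(lia).
    rewrite hk; rewrite subnKC ?(ltnW kj) // in Qk *; rewrite Qk ifF //; lia.
  + have [] := hp 0 ltac:(lia); rewrite addn0 eqxx => _ Qk.
    by rewrite kj subnn -Qk.
- by move=> _; elim: (j) pj => // k IH /peak_down.
Qed.

End Classification.

(** * Generators on a path *)

Definition level_m i j : nat :=
  if i == j then 1 else if (i == j.+1) || (j == i.+1) then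
    if (i == 0) || (j == 0) then 4 else 3
  else 2.

Lemma level_m2 i j : level_m i j = 2 <-> [/\ i != j, i != j.+1 & j != i.+1].
Proof.
rewrite /level_m; split; last by case=> /negbTE -> /negbTE -> /negbTE ->.
by case: eqP => // _; case: eqP => // _; case: eqP => // _; case: ifP.
Qed.

Lemma level_m_neq2 i k : (level_m i k != 2) = [|| i == k, i == k.+1 | k == i.+1].
Proof.
rewrite /level_m; case: (i == k) => //.
by case: (i == k.+1) => /=; [|case: (k == i.+1)]; do ?case: ifP.
Qed.

Section Levels.
Variables (n : nat) (A : finType).
Implicit Types (u w : seq (A + 'I_n.-1)).

(** The position of a generator on the path that results from gluing together
    all generators at its head. *)
Definition level (x : A + 'I_n.-1) : nat := if x is inr i then (val i).+1 else 0.

Definition levels u := map level u.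

Lemma level_lt x : 0 < n -> level x < n.
Proof. by case: x => [//|i] /= n0; have := ltn_ord i; lia. Qed.

Lemma levels_lt u : 0 < n -> all (fun i => i < n) (levels u).
Proof. by move=> n0; apply/allP => _ /mapP[x _ ->]; exact: level_lt. Qed.

Lemma level_inj_pos x y : 0 < level x -> level x = level y -> x = y.
Proof. by case: x y => [a|i] [b|j] //= _ [/val_inj ->]. Qed.

Lemma level_ex (a : A) i : i < n -> exists x, level x = i.
Proof.
case: i => [|i] ni; first by exists (inl a).
have ni' : i < n.-1 by lia.
by exists (inr (Ordinal ni')).
Qed.

Lemma levels_ex (a : A) v : all (fun i => i < n) v -> exists u, levels u = v.
Proof.
elim: v => [|i v IH] /=; first by exists [::].
by case/andP=> /(level_ex a)[x <-] /IH[u <-]; exists (x :: u).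
Qed.

Lemma proj_levels i u : proj i (levels u) =
  levels (filter (fun x => pred2 i i.+1 (level x)) u).
Proof. by rewrite /proj filter_map. Qed.

Lemma map_altw k s t : levels (altw k s t) = altw k (level s) (level t).
Proof. by elim: k s t => //= k IH s t; rewrite IH. Qed.
End Levels.

Lemma realizes_proj n j h p v w : realizes n j h p v -> all (fun i => i < n) w ->
  (forall i, i < n -> proj i v = proj i w) -> realizes n j h p w.
Proof. by move=> [vn vp] wn vw; split=> // i ni; rewrite -vw // vp. Qed.

(** * Type B *)

Section TypeB.
Variable n : nat.
Hypothesis hn : 2 <= n.
Local Notation S := (unit + 'I_n.-1)%type.
Local Notation m := (coxB n).
Local Notation lv := (@level n unit).
Implicit Types (x y : S) (u v w : seq S).

Let n0 : 0 < n. Proof. exact: ltnW. Qed.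

Lemma level_injB : injective lv.
Proof. by move=> [[]|i] [[]|j] //= [/val_inj ->]. Qed.

Lemma coxB_level x y : m x y = level_m (lv x) (lv y).
Proof.
rewrite /level_m; case: x y => [[]|i] [[]|j] //=.
by case: (val i).
Qed.

Lemma B_not_commute x y : m x y <> 2 ->
  [\/ lv x = lv y, lv x = (lv y).+1 | lv y = (lv x).+1].
Proof.
rewrite coxB_level /level_m; case: eqP => [->|_]; first by constructor 1.
case: eqP => [->|_]; first by constructor 2.
by case: eqP => [->|_] //; constructor 3.
Qed.

Lemma realizesB_commeq u v j h p : commeq m u v ->
  realizes n j h p (levels u) -> realizes n j h p (levels v).
Proof.
move=> uv ru; apply: realizes_proj ru (levels_lt _ n0) _ => i _.
rewrite !proj_levels; congr levels; apply: commeq_filter uv => x y.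
rewrite coxB_level => /level_m2[xy xSy ySx].
by apply/negP => /andP[/pred2P[ex|ex] /pred2P[ey|ey]]; move: xy xSy ySx;
  rewrite ex ey eqxx ?andbF.
Qed.

(** Noncommuting generators are equal or neighbours on the path, so the
    projections recorded by a code determine the class. *)
Lemma realizesB_inj u v j h p : realizes n j h p (levels u) ->
  realizes n j h p (levels v) -> commeq m u v.
Proof.
move=> [_ ru] [_ rv]; apply: commeq_of_proj.
have E (P : pred nat) : (exists2 i, i < n & forall k, P k -> (k == i) || (k == i.+1)) ->
    filter (fun x => P (lv x)) u = filter (fun x => P (lv x)) v.
  case=> i ni Pi; apply: (inj_map level_injB).
  rewrite -!filter_map.
  have F w : filter P (levels w) = filter P (proj i (levels w)).
    rewrite /proj -filter_predI; apply: eq_filter => k /=.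
    by case e: (P k) => //=; rewrite Pi.
  by rewrite -/(levels u) -/(levels v) F [RHS]F ru // rv.
move=> x y /B_not_commute xy.
have := E (pred2 (lv x) (lv y)); rewrite !(eq_filter (a2 := pred2 x y)); last first.
- by move=> z /=; rewrite !(inj_eq level_injB).
- by move=> z /=; rewrite !(inj_eq level_injB).
apply; case: xy => e.
- by exists (lv x); [exact: level_lt|move=> k /=; rewrite e orbb => ->].
- by exists (lv y); [exact: level_lt|move=> k /=; rewrite e orbC].
- by exists (lv x); [exact: level_lt|move=> k /=; rewrite e].
Qed.

Lemma realizesB_allowed u j h p : code_ok n j h p -> realizes n j h p (levels u) ->
  ~ forbidden m u.
Proof.
move=> ok ru [a [b [s [t]]]].
have inf w : u = a ++ w ++ b -> infix (levels w) (levels u).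
  by move=> ->; apply/infixP; exists (levels a), (levels b); rewrite /levels !map_cat.
case=> [/(inf [:: s; s])|[m3 /inf]].
  by rewrite /= (negbTE (realizes_no_square _ ru)).
rewrite map_altw; move: m3 (level_lt s n0) (level_lt t n0).
rewrite coxB_level; move: (lv s) (lv t) => i k; rewrite /level_m.
case: eqP => // _; case: eqP => [->|_].
  case: k => [|k] _ ni nk /=; first by rewrite (negbTE (realizes_no_braid4 ok ru hn).2).
  by rewrite (negbTE (realizes_no_braid3_down ok ru ni)).
case: eqP => [->|_] // _; case: i => [|i] ni nk /=.
  by rewrite (negbTE (realizes_no_braid4 ok ru hn).1).
by rewrite (negbTE (realizes_no_braid3_up ok ru nk)).
Qed.

Lemma split_levelsB u a i b c : levels u = a ++ i :: b ++ i :: c ->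
  exists a' x b' c', [/\ u = a' ++ x :: b' ++ x :: c', lv x = i,
    levels a' = a, levels b' = b & levels c' = c].
Proof.
move=> /map_split[a' [x [r [-> ea ex /map_split[b' [y [c' [-> eb ey ec]]]]]]]].
have exy : y = x by apply: level_injB; rewrite ey.
by subst y; exists a', x, b', c'.
Qed.

Lemma commute_levelsB x b : lv x \notin levels b -> (lv x).+1 \notin levels b ->
  (forall i, lv x = i.+1 -> i \notin levels b) -> forall y, y \in b -> m x y = 2.
Proof.
move=> xb Sb Pb y yb; have lyb : lv y \in levels b by apply: map_f.
rewrite coxB_level; apply/level_m2; split.
- by apply: contra xb => /eqP ->.
- by apply/negP => /eqP/Pb; rewrite lyb.
- by apply: contra Sb => /eqP <-.
Qed.

Lemma fcword_gap_conditionsB u : fcword m u -> gap_conditions n (levels u).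
Proof.
move=> fu; split; first exact: levels_lt.
- move=> a b c /split_levelsB[a' [x [b' [c' [eu ex _ <- _]]]]] b0; subst u.
  have [y yb /B_not_commute] := fcword_gap fu; rewrite ex => -[e|e|e] //.
    by rewrite e map_f in b0.
  by rewrite -e map_f.
- move=> a b c /split_levelsB[a' [x [b' [c' [eu ex _ <- _]]]]] b1; subst u.
  case: (boolP (0 \in levels b')) => b0; [by left|right].
  have [y yb xy] := fcword_gap fu; have [e|e|e] := B_not_commute xy.
  + by move: b1; rewrite -ex e map_f.
  + by move: b0; rewrite ex in e; case: e => ->; rewrite map_f.
  rewrite ltnNge; apply/negP => c2; case/split_first: (yb) => d1 [d2 [eb _]].
  subst b'; move: b0 b1 c2; rewrite /levels map_cat /= e ex count_cat /=.
  rewrite !mem_cat !inE !negb_or => /and3P[d10 _ d20] /and3P[d11 _ d21] c2.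
  have [/count_memPn d12 /count_memPn d22] := sum_le1 c2.
  rewrite -catA in fu; case: (fcword_gap1 fu).
  + by apply: commute_levelsB; rewrite ex // => i [<-].
  + by apply: commute_levelsB; rewrite ex // => i [<-].
  + by rewrite coxB_level ex e ex.
- move=> i a b c /split_levelsB[a' [x [b' [c' [eu ex _ <- _]]]]] bi; subst u.
  have xb : x \notin b' by apply: contra bi => xb; rewrite -ex map_f.
  have m3 y : y \in b' -> 0 < m x y <= 3.
    move=> _; rewrite coxB_level ex /level_m; case: eqP => // _.
    by case: (lv y) => [|k] //; case: ifP.
  have := fcword_gap_laced m3 fu xb.
  rewrite (eq_in_count (a2 := preim lv (pred2 i.+1 i.+3))); last first.
    move=> y yb; rewrite coxB_level ex level_m_neq2 /=.
    have /negbTE -> : i.+2 != lv y by apply: contra bi => /eqP ->; rewrite map_f.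
    by rewrite eqSS eq_sym.
  by rewrite -count_map count_pred2 // neq_ltn; apply/orP; left; lia.
- move=> a b d c e b0 b1 d1 d2 d0.
  have /split_first[d' [d'' [ed _]]] : 0 \in d by rewrite -has_pred1 has_count d0.
  move: d0 d1 d2; rewrite ed count_cat /= =>
    /sum_eq1[/count_memPn d'0 /count_memPn d''0].
  rewrite !mem_cat !inE !negb_or => /and3P[d'1 _ d''1] /and3P[d'2 _ d''2].
  rewrite ed -catA /= in e.
  have [a' [x [r [eu _ ex er]]]] := map_split e.
  have [b' [y [r1 [er1 eb ey er']]]] := map_split er.
  have [e1 [x' [r2 [er2 ed1 ex' er2']]]] := map_split er'.
  have [e2 [y' [c' [ec ed2 ey' _]]]] := map_split er2'.
  have exx : x' = x by apply: level_injB; rewrite ex.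
  have eyy : y' = y by apply: level_injB; rewrite ey.
  subst; apply: (fcword_gap4 _ fu); first by rewrite coxB_level ex' ey'.
  + by apply: commute_levelsB; rewrite ex'.
  + by apply: commute_levelsB; rewrite ex'.
  + by apply: commute_levelsB; rewrite ey' // => i [<-].
  + by apply: commute_levelsB; rewrite ey' // => i [<-].
- move=> a b d c e b0 b1 d1 d2 d0.
  have /split_first[d' [d'' [ed _]]] : 0 \in d by rewrite -has_pred1 has_count d0.
  move: d0 d1 d2; rewrite ed count_cat /= =>
    /sum_eq1[/count_memPn d'0 /count_memPn d''0].
  rewrite !mem_cat !inE !negb_or => /and3P[d'1 _ d''1] /and3P[d'2 _ d''2].
  rewrite ed -catA /= in e.
  have [a' [x [r [eu _ ex er]]]] := map_split e.
  have [e1 [y [r1 [er1 ed1 ey er']]]] := map_split er.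
  have [e2 [x' [r2 [er2 ed2 ex' er2']]]] := map_split er'.
  have [b' [y' [c' [ec eb ey' _]]]] := map_split er2'.
  have exx : x' = x by apply: level_injB; rewrite ex.
  have eyy : y' = y by apply: level_injB; rewrite ey.
  subst; apply: (fcword_gap4 _ fu); first by rewrite coxB_level ex' ey'.
  + by apply: commute_levelsB; rewrite ex' // => i [<-].
  + by apply: commute_levelsB; rewrite ex' // => i [<-].
  + by apply: commute_levelsB; rewrite ey'.
  + by apply: commute_levelsB; rewrite ey'.
Qed.

Local Open Scope ring_scope.

Definition cartanB x y : int :=
  if lv x == lv y then 2
  else if (lv x == (lv y).+1) || (lv y == (lv x).+1) then
    if lv x == 0%N then -2 else -1
  else 0.

Lemma cartanB_diag x : cartanB x x = 2.
Proof. by rewrite /cartanB eqxx. Qed.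

Lemma cartanB_off x y : x <> y ->
  [\/ [/\ m x y = 2%N, cartanB x y = 0 & cartanB y x = 0],
      [/\ m x y = 3%N, cartanB x y = -1 & cartanB y x = -1],
      [/\ m x y = 4%N, cartanB x y = -1 & cartanB y x = -2] |
      [/\ m x y = 4%N, cartanB x y = -2 & cartanB y x = -1]].
Proof.
move=> xy; have : lv x <> lv y by move/level_injB.
rewrite coxB_level /cartanB /level_m; move: (lv x) (lv y) => i k ik.
rewrite (orbC (k == i.+1)) (eq_sym k i); case: eqP => // _.
case: (i =P k.+1) => [->|_] /=.
  by case: k {ik} => [|k]; [constructor 3|constructor 2].
case: (k =P i.+1) => [->|_] /=; last by constructor 1.
by case: i {ik} => [|i]; [constructor 4|constructor 2].
Qed.

End TypeB.

(** * Enumeration of the codes *)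

Notation code := (nat * nat * seq step)%type.

(** The walks from any height at 0 encode the alternating words; the walks from
    height 1 at j encode those with a chain of index j, and for j = 0 the
    alternating words with a single letter 0. *)
Definition codes_head n : seq code :=
  [seq (0, h, p) | h <- iota 0 n.+1, p <- walks true n h].

Definition codes_chain n j0 : seq code :=
  [seq (j, 1, p) | j <- iota j0 (n - j0), p <- walks true (n - j) 1].

Lemma mem_codes_head n c : 0 < n ->
  (c \in codes_head n) = (c.1.1 == 0) && code_ok n c.1.1 c.1.2 c.2.
Proof.
move=> n0; case: c => [[j h] p]; apply/allpairsPdep/idP => [|/=].
  case=> h' [p' [_ + [-> -> ->]]] /=; rewrite mem_walks => /andP[sp wp].
  by rewrite /code_ok subn0 sp wp n0.
case/andP=> /eqP -> /and4P[sp wp _ _]; rewrite subn0 in sp.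
exists h, p; split=> //; last by rewrite mem_walks sp wp.
by rewrite -[_ :: _]/(iota 0 n.+1) mem_iota /= ltnS -(eqP sp) (walk_ok_le wp).
Qed.

Lemma mem_codes_chain n j0 c :
  (c \in codes_chain n j0) = [&& j0 <= c.1.1, c.1.2 == 1 & code_ok n c.1.1 c.1.2 c.2].
Proof.
case: c => [[j h] p]; apply/allpairsPdep/idP => /=.
  case=> h' [p' [+ + [-> -> ->]]]; rewrite mem_walks mem_iota => jn /andP[sp wp].
  by rewrite /code_ok sp wp eqxx implybT /=; lia.
case/and3P=> jj /eqP -> /and4P[sp wp jn _].
exists j, p; split=> //; last by rewrite mem_walks sp wp.
by rewrite mem_iota; lia.
Qed.

Lemma uniq_codes_head n : uniq (codes_head n).
Proof.
apply: allpairs_uniq_dep => [|h _|]; first exact: iota_uniq.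
  exact: uniq_walks.
by move=> [h p] [h' p'] _ _ /= [-> ->].
Qed.

Lemma uniq_codes_chain n j0 : uniq (codes_chain n j0).
Proof.
apply: allpairs_uniq_dep => [|h _|]; first exact: iota_uniq.
  exact: uniq_walks.
by move=> [h p] [h' p'] _ _ /= [-> ->].
Qed.

Definition code_size (c : code) := 2 * c.1.1 + area c.1.2 c.2.

Section CodeSums.
Local Open Scope ring_scope.

Lemma sum_codes_head n :
  \sum_(c <- codes_head n) 'X^(code_size c) = fcoef Qstarx n :> {poly int}.
Proof. by rewrite fcoef_Qstarx big_allpairs_dep. Qed.

Lemma sum_codes_chain n j0 : (j0 <= n)%N ->
  \sum_(c <- codes_chain n j0) 'X^(code_size c) =
  \sum_(j0 <= j < n) 'X^(2 * j) * walk_poly true (n - j) 1 :> {poly int}.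
Proof.
move=> jn; rewrite big_allpairs_dep /index_iota; apply: eq_bigr => j _.
by rewrite /walk_poly big_distrr; apply: eq_bigr => p _; rewrite /code_size exprD.
Qed.

Definition codesB n := codes_head n ++ codes_chain n 1.

Theorem FCpoly_B n : (2 <= n)%N ->
  FCpoly (coxB n) = \sum_(c <- codesB n) 'X^(code_size c).
Proof.
move=> hn; have n0 : (0 < n)%N by exact: ltnW.
have okB c : c \in codesB n -> code_ok n c.1.1 c.1.2 c.2.
  by rewrite mem_cat mem_codes_head // mem_codes_chain => /orP[/andP[]|/and3P[]].
apply: (@FCpoly_codes _ _ _ _ _ _ _
  (fun u c => realizes n c.1.1 c.1.2 c.2 (levels u))).
- exact: crystallographic_gt0 (@cartanB_off n).
- exact: crystallographic_exact (@cartanB_diag n) (@cartanB_off n).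
- rewrite cat_uniq uniq_codes_head uniq_codes_chain andbT /=.
  apply/hasPn => c; rewrite mem_codes_chain mem_codes_head // => /and3P[c1 _ _].
  by case: (c.1.1) c1.
- by move=> u v c uv; exact: realizesB_commeq.
- move=> u /(fcword_gap_conditionsB hn)/gap_conditions_realizes/(_ n0).
  case=> j [h [p [ok ru _]]]; exists (j, h, p) => //.
  rewrite mem_cat mem_codes_head // mem_codes_chain /= ok !andbT.
  by case: j ok {ru} => [|j] ok //; rewrite (code_peak_height ok).
- move=> c /okB/realizes_ex[v rv].
  have [u uv] := levels_ex tt rv.1; exists u; rewrite uv; exact: rv.
- by move=> u c /okB ok; exact: realizesB_allowed.
- by move=> u v c _; exact: realizesB_inj.
- move=> u [[j h] p] [[j' h'] p'] /okB ok /okB ok' ru ru'.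
  by have [/= -> -> ->] := realizes_fun ok ok' ru ru'.
- by move=> u c /okB ok /(realizes_size ok); rewrite size_map.
Qed.

Corollary FCpoly_B_series n : (2 <= n)%N -> FCpoly (coxB n) =
    fcoef (Qstarx + sx ^+ 2 * sq ^+ 3 / (1 - sx * sq ^+ 2)
                    * Mstarx * fps_dilate 'X Mx) n.
Proof.
move=> hn; have n0 : (0 < n)%N by exact: ltnW.
rewrite FCpoly_B // big_cat sum_codes_head sum_codes_chain //.
by rewrite fcoefD fcoef_B_peaks.
Qed.

End CodeSums.

(** * Type D *)

Section TypeD.
Variable n : nat.
Hypothesis hn : 2 <= n.
Local Notation S := (bool + 'I_n.-1)%type.
Local Notation m := (coxDS n).
Local Notation lv := (@level n bool).
Local Notation t c := (inl c : S).
Local Notation is_t := (fun x : S => lv x == 0).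
Local Notation erase c := (filter (predC1 (t c))).
Implicit Types (x y z : S) (u w : seq S).

Let n0 : 0 < n. Proof. exact: ltnW. Qed.

Lemma is_tP x : reflect (exists c, x = t c) (lv x == 0).
Proof.
by case: x => [c|i] /=; [apply: ReflectT; exists c|apply: ReflectF; case].
Qed.

Lemma coxD_level x y : m x y = if x == y then 1
  else if (lv x == (lv y).+1) || (lv y == (lv x).+1) then 3 else 2.
Proof.
case: x y => [c|i] [d|j] //=.
by rewrite orbF.
Qed.

Lemma D_not_commute x y : m x y <> 2 ->
  [\/ x = y, lv x = (lv y).+1 | lv y = (lv x).+1].
Proof.
rewrite coxD_level; case: eqP => [->|_]; first by constructor 1.
case: eqP => [->|_]; first by constructor 2.
by case: eqP => [->|_] //; constructor 3.
Qed.

Lemma D_commute x y : m x y = 2 ->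
  [/\ x <> y, lv x <> (lv y).+1 & lv y <> (lv x).+1].
Proof.
by rewrite coxD_level; case: eqP => // xy; case: eqP => // xSy; case: eqP.
Qed.

Lemma coxD_le3 x y : 0 < m x y <= 3.
Proof. by rewrite coxD_level; case: ifP => // _; case: ifP. Qed.

Lemma commuteD_letters x b : x \notin b -> (lv x).+1 \notin levels b ->
  (forall i, lv x = i.+1 -> i \notin levels b) -> forall y, y \in b -> m x y = 2.
Proof.
move=> xb Sb Pb y yb; have lyb : lv y \in levels b by apply: map_f.
apply: contrapT => /D_not_commute[e|/Pb|e].
- by rewrite e yb in xb.
- by rewrite lyb.
- by rewrite -e lyb in Sb.
Qed.

Lemma mem_levels0 b : reflect (exists c, t c \in b) (0 \in levels b).
Proof.
apply: (iffP mapP) => [[x xb e]|[c cb]]; last by exists (t c).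
by case/esym/eqP/is_tP: e => c ex; exists c; rewrite -ex.
Qed.

Lemma split_levelsD u a i b c : levels u = a ++ i.+1 :: b ++ i.+1 :: c ->
  exists a' x b' c', [/\ u = a' ++ x :: b' ++ x :: c', lv x = i.+1,
    levels a' = a, levels b' = b & levels c' = c].
Proof.
move=> /map_split[a' [x [r [-> ea ex /map_split[b' [y [c' [-> eb ey ec]]]]]]]].
have exy : y = x by apply: level_inj_pos; rewrite ey.
by subst y; exists a', x, b', c'.
Qed.

Lemma count_erase e b i :
  count_mem i.+1 (levels (erase e b)) = count_mem i.+1 (levels b).
Proof. by elim: b => //= x b IH; case: eqP => [->|_] /=; rewrite IH. Qed.

(** ** Gaps in fully commutative words *)

Section Gap.
Variable w : seq S.
Hypothesis fw : fcword m w.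

Lemma fcwordD_gap i a z b d : w = a ++ z :: b ++ z :: d -> lv z = i.+1 ->
  i.+1 \notin levels b -> 1 < count_mem i (levels b) + count_mem i.+2 (levels b).
Proof.
move=> ew ez ib; have zb : z \notin b.
  by apply: contra ib => zb; rewrite -ez map_f.
have fw' := fw; rewrite ew in fw'.
have := fcword_gap_laced (fun y _ => coxD_le3 z y) fw' zb.
rewrite (eq_in_count (a2 := preim lv (pred2 i i.+2))); last first.
  move=> y yb; rewrite coxD_level ez /=.
  have /negbTE -> : z != y by apply: contra zb => /eqP ->.
  by rewrite eqSS (eq_sym i); case: (_ || _).
by rewrite -count_map count_pred2 // neq_ltn; apply/orP; left; lia.
Qed.

Lemma fcwordD_gap0 a c b d : w = a ++ t c :: b ++ t c :: d -> t c \notin b ->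
  1 < count_mem 1 (levels b).
Proof.
move=> ew cb; have fw' := fw; rewrite ew in fw'.
have := fcword_gap_laced (fun y _ => coxD_le3 (t c) y) fw' cb.
rewrite (eq_in_count (a2 := preim lv (pred1 1))); first by rewrite -count_map.
move=> y yb; rewrite coxD_level /=.
have /negbTE -> : t c != y by apply: contra cb => /eqP ->.
by case: (lv y) => [|[|k]].
Qed.

Lemma levels_gap_SS i a b c : levels w = a ++ i.+2 :: b ++ i.+2 :: c ->
  i.+2 \notin b -> 1 < count_mem i.+1 b + count_mem i.+3 b.
Proof.
by move=> /split_levelsD[a' [x [b' [c' [eu ex _ <- _]]]]]; exact: (fcwordD_gap eu ex).
Qed.

Lemma levels_gap_1 a b c : levels w = a ++ 1 :: b ++ 1 :: c -> 1 \notin b ->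
  count_mem 2 b <= 1 /\ 0 \in b.
Proof.
move=> e b1; have c2 := gap_above (levels_lt w n0) levels_gap_SS e b1.
split=> //; have [a' [x [b' [c' [ew ex _ eb _]]]]] := split_levelsD e.
have := fcwordD_gap ew ex; rewrite eb => /(_ b1) c02.
by rewrite -has_pred1 has_count -(ltn_add2r (count_mem 2 b)) add0n (leq_ltn_trans c2).
Qed.

(** Every gap of s_1 contains t_1 or t_2. *)
Lemma factor_no_t (x s y : seq S) : w = x ++ s ++ y -> 0 \notin levels s ->
  count_mem 1 (levels s) <= 1.
Proof.
move=> ew s0; rewrite leqNgt; apply/negP => /split_two[a [b [c [es b1]]]].
have e : levels w = (levels x ++ a) ++ 1 :: b ++ 1 :: (c ++ levels y).
  by rewrite ew /levels !map_cat -/(levels s) es -?catA /= -?catA.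
by move: s0; rewrite es !(mem_cat, inE) (levels_gap_1 e b1).2 !orbT.
Qed.

(** Every gap of t_1 contains s_1, and likewise for t_2. *)
Lemma factor_no_s1 (x s y : seq S) c : w = x ++ s ++ y -> 1 \notin levels s ->
  count_mem (t c) s <= 1.
Proof.
move=> ew s1; rewrite leqNgt; apply/negP => /split_two[a [b [d [es bc]]]].
have e : w = (x ++ a) ++ t c :: b ++ t c :: (d ++ y).
  by rewrite ew es -?catA /= -?catA.
have := fcwordD_gap0 e bc; move: s1.
by rewrite es /levels map_cat mem_cat /= inE map_cat mem_cat !negb_or
  => /and3P[_ _ /andP[/count_memPn -> _]].
Qed.

Definition separated := forall a b d c,
  w = a ++ t c :: b ++ t (~~ c) :: d -> 1 \in levels b.

Lemma separated_gap_conditions : separated -> gap_conditions n (levels w).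
Proof.
have no01 a b d c : levels w = a ++ 1 :: d ++ 1 :: b ++ c -> 1 \notin d -> 2 \notin d ->
    count_mem 0 d = 1 -> False.
  move=> e d1 d2 d0; have [a' [x [b' [c' [ew ex _ eb _]]]]] := split_levelsD e.
  by have := fcwordD_gap ew ex; rewrite eb d0 (count_memPn d2) => /(_ d1).
move=> sep; split.
- exact: levels_lt.
- move=> a b c /map_split[a' [x [r [ew _ /eqP/is_tP[c1 ex]
    /map_split[b' [y [c' [er <- /eqP/is_tP[c2 ey] _]]]]]]]] b0; subst x r y.
  have [e|e] := eqVneq c2 c1.
    subst c2; have fw' := fw; rewrite ew in fw'.
    have [y' yb' /D_not_commute[ey|//|/= <-]] := fcword_gap fw'; last exact: map_f.
    by case/negP: b0; apply/mapP; exists y' => //; rewrite -ey.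
  by apply: (sep a' b' c' c1); rewrite ew; case: c1 c2 e {ew} => [] [].
- by move=> a b c e /(levels_gap_1 e)[_ b0]; left.
- exact: levels_gap_SS.
- move=> a b d c e _ _ d1 d2 d0; apply: (no01 (a ++ 0 :: b) [::] d c) => //.
  by rewrite e -catA.
- by move=> a b d c e _ _; exact: (no01 a b d (0 :: c)).
Qed.

(** Between letters t_1 and t_2 that s_1 does not separate there is no other t_1 or
    t_2, so everything in between commutes with them. *)
Lemma not_separated : ~ separated -> exists a c d,
  commeq m w (a ++ t c :: t (~~ c) :: d).
Proof.
move=> nsep; apply: contrapT => nex; apply: nsep => a b d c ew.
apply/negPn/negP => b1; apply: nex; exists (a ++ b), c, d; rewrite ew -catA.
have bt e : t e \notin b.
  have := @factor_no_s1 a (t c :: b ++ [:: t (~~ c)]) d e.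
  rewrite -cat_cons -catA /= => /(_ ew);
    rewrite /levels /= map_cat inE mem_cat (negbTE b1) /=.
  move=> /(_ (erefl _)); rewrite count_cat /= => h.
  apply/negP; rewrite -has_pred1 has_count => bpos.
  have {h} : (t c == t e) + (count_mem (t e) b + (t (~~ c) == t e)) <= 1.
    by rewrite addn0 in h.
  by rewrite -[t c == t e]/(c == e) -[t (~~ c) == t e]/(~~ c == e);
    case: c e bpos {ew} => [] [] /=; lia.
apply: commeq_catl; apply: commeq_right => y yb.
by apply: commuteD_letters yb => //=; apply: bt.
Qed.

(** Once t_1 and t_2 are adjacent, they do not occur elsewhere: the next
    occurrence of one of them would enclose two letters s_1 without enclosing
    any letter t_1 or t_2 between them. *)
Lemma adjacent_unique a c d : w = a ++ t c :: t (~~ c) :: d ->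
  0 \notin levels a /\ 0 \notin levels d.
Proof.
move=> ew.
have no_t b e : 0 \notin levels b -> t e \notin b.
  by move=> b0; apply: contra b0 => teb; apply/mem_levels0; exists e.
split; apply/negP.
- case/split_last => a1 [a2 [/map_split[b1 [x [b2 [ea _ /eqP/is_tP[e ex] e2]]]] a20]].
  subst x a2 a.
  have /factor_no_t/(_ a20) : w = (b1 ++ [:: t e]) ++ b2 ++ (t c :: t (~~ c) :: d).
    by rewrite ew -?catA.
  rewrite leqNgt => /negP; apply; have [ec|ec] := eqVneq e c.
    apply: (@fcwordD_gap0 b1 e b2 (t (~~ c) :: d)); last exact: no_t.
    by rewrite ew ec -?catA.
  have {}ec := eq_negb ec.
  have := @fcwordD_gap0 b1 e (b2 ++ [:: t c]) d.
  rewrite /levels map_cat count_cat /= !addn0; apply; first by rewrite ew ec -?catA.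
  by rewrite mem_cat negb_or no_t // inE ec; case: (c).
- case/split_first => d1 [d2 [/map_split[b1 [x [b2 [ed e1 /eqP/is_tP[e ex] _]]]] d10]].
  subst x d1 d.
  have /factor_no_t/(_ d10) : w = (a ++ [:: t c; t (~~ c)]) ++ b1 ++ (t e :: b2).
    by rewrite ew -?catA.
  rewrite leqNgt => /negP; apply; have [ec|ec] := eqVneq e c.
    have := @fcwordD_gap0 a e (t (~~ c) :: b1) b2.
    rewrite /=; apply; first by rewrite ew ec.
    by rewrite inE negb_or no_t // andbT ec; case: (c).
  have {}ec := eq_negb ec.
  apply: (@fcwordD_gap0 (a ++ [:: t c]) e b1 b2); last exact: no_t.
  by rewrite ew ec -?catA.
Qed.

(** A gap of s_1 that contains the erased letter also contains the other one, so
    the gaps of the remaining word are those of type B_n. *)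
Lemma adjacent_gap_conditions a c d : w = a ++ t c :: t (~~ c) :: d ->
  gap_conditions n (levels (a ++ t c :: d)) /\ count_mem 0 (levels (a ++ t c :: d)) = 1.
Proof.
move=> ew; have [a0 d0] := adjacent_unique ew.
set v := levels _.
have v0 : count_mem 0 v = 1.
  by rewrite /v /levels map_cat count_cat /= (count_memPn a0) (count_memPn d0).
have ve : v = levels (erase (~~ c) w).
  rewrite /v ew !filter_cat /= eqxx; have -> : t c != t (~~ c) by case: (c).
  have no_t b : 0 \notin levels b -> filter (predC1 (t (~~ c))) b = b.
    move=> b0; apply/all_filterP/allP => x xb /=; apply: contra b0 => /eqP ex.
    by apply/mem_levels0; exists (~~ c); rewrite -ex.
  by rewrite !no_t.
have lift i b1 b2 b3 : v = b1 ++ i.+1 :: b2 ++ i.+1 :: b3 -> i.+1 \notin b2 ->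
    exists c1 z c2 c3, [/\ w = c1 ++ z :: c2 ++ z :: c3, lv z = i.+1,
      levels (erase (~~ c) c2) = b2 & i.+1 \notin levels c2].
  rewrite ve => /split_levelsD[e1 [z [e2 [e3 [ee ez _ <- _]]]]] ie.
  have [c1 [r [ew1 _ er]]] := filter_split ee.
  have [c2 [c3 [er2 e2E _]]] := filter_split er.
  exists c1, z, c2, c3; rewrite ew1 er2 e2E; split=> //.
  apply: contra ie => /mapP[y yc ey]; apply/mapP; exists y => //.
  by rewrite -e2E mem_filter yc andbT /=; apply: contraPneq ey => ->.
have no2 b1 b2 b3 : v <> b1 ++ 0 :: b2 ++ 0 :: b3.
  by move=> e; move: v0; rewrite e count_cat /= count_cat /=; lia.
split=> //; split.
- exact: levels_lt.
- by move=> b1 b2 b3 /no2.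
- move=> b1 b2 b3 e b21; left;
  have [c1 [z [c2 [c3 [ew1 ez eb c21]]]]] := lift _ _ _ _ e b21.
  have ew1' : levels w = levels c1 ++ 1 :: levels c2 ++ 1 :: levels c3.
    by rewrite ew1 /levels map_cat /= map_cat /= ez.
  have [_ /mem_levels0[e' tc2]] := levels_gap_1 ew1' c21.
  suff tc : t c \in c2.
    rewrite -eb; apply/mem_levels0; exists c; rewrite mem_filter tc andbT /=.
    by case: (c).
  have [<-//|e'c] := eqVneq e' c; have {e'c} ? := eq_negb e'c.
  subst e'; have [f1 [f2 [ec2 tf1]]] := split_first tc2.
  have no_t b : 0 \notin levels b -> t (~~ c) \notin b.
    by move=> b0; apply: contra b0 => tb; apply/mem_levels0; exists (~~ c).
  have cw : count_mem (t (~~ c)) w = 1.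
    rewrite ew count_cat /= eqxx (count_memPn (no_t _ a0)) (count_memPn (no_t _ d0)).
    by case: (c).
  have ew2 : w = (c1 ++ z :: f1) ++ t (~~ c) :: (f2 ++ z :: c3).
    by rewrite ew1 ec2 -?catA /= -?catA.
  have : c1 ++ z :: f1 = a ++ [:: t c].
    apply: (@split_unique _ (t (~~ c)) _ _ (f2 ++ z :: c3) d).
    - by rewrite -ew2 ew -catA.
    - apply/count_memPn; move: cw; rewrite ew2 count_cat /= eqxx.
      by move/sum_eq1 => [].
    - by rewrite mem_cat inE negb_or no_t //=; case: (c).
  move/(congr1 (last z)); rewrite !last_cat /= => el.
  rewrite ec2 mem_cat; case/lastP: f1 el {ec2 tf1 ew2} => [|f1 x] /=.
    by move=> ezt; rewrite ezt in ez.
  by rewrite last_rcons mem_rcons => ->; rewrite mem_head.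
- move=> i b1 b2 b3 e ib; have [c1 [z [c2 [c3 [ew1 ez <- ic2]]]]] := lift _ _ _ _ e ib.
  by rewrite !count_erase; exact: fcwordD_gap ew1 ez ic2.
- move=> b1 b2 b3 b4 e _ _ _ _ d1; move: v0;
  rewrite e count_cat /= count_cat /= count_cat /= d1; lia.
- move=> b1 b2 b3 b4 e _ _ _ _ d1; move: v0;
  rewrite e count_cat /= count_cat /= count_cat /= d1; lia.
Qed.

End Gap.

(** ** Encoding *)

(** Words in which t_1 and t_2 are separated by s_1: merging them gives an
    alternating word of type B_n, and e tells which of them comes first. *)
Definition alternates w (e : bool) h p :=
  realizes n 0 h p (levels w) /\ filter is_t w = altw h (t e) (t (~~ e)).

(** Words in which t_1 and t_2 can be made adjacent. Requiring the same code from
    both erasures says that t_1 and t_2 occupy the same place among the letters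
    s_1, in terms of projections only. *)
Definition blocks w j p := forall e, realizes n j 1 p (levels (erase e w)).

Lemma levels_inj u u' : levels u = levels u' ->
  filter is_t u = filter is_t u' -> u = u'.
Proof.
elim: u u' => [|x u IH] [|x' u'] //= [exx eu]; rewrite -exx.
case: eqP => [_ [-> /IH -> //]|x0 /IH -> //].
by congr (_ :: _); apply: level_inj_pos => //; rewrite lt0n; apply/eqP.
Qed.

Lemma levels_inj_erased e u u' : levels u = levels u' -> t e \notin u ->
  t e \notin u' ->
  u = u'.
Proof.
elim: u u' => [|x u IH] [|x' u'] //= [exx /IH eu].
rewrite !inE !negb_or => /andP[ex /eu {}eu] /andP[ex' /eu ->]; congr (_ :: _).
have [x0|] := posnP (lv x); last by move/level_inj_pos; exact.
have x0' : lv x' = 0 by rewrite -exx.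
move/eqP/is_tP: x0 => [c ec]; move/eqP/is_tP: x0' => [c' ec']; subst x x'.
by case: e c c' ex ex' {IH eu exx} => [] [] [].
Qed.

Lemma noncommuting_pair x y : m x y <> 2 -> exists2 i, i < n &
  forall z, pred2 x y z -> pred2 i i.+1 (lv z).
Proof.
move=> xy; have [e|e|e] := D_not_commute xy.
- exists (lv x); first exact: level_lt.
  by move=> z /pred2P[|] -> /=; rewrite -?e eqxx.
- exists (lv y); first exact: level_lt.
  by move=> z /pred2P[|] -> /=; rewrite ?e eqxx ?orbT.
- exists (lv x); first exact: level_lt.
  by move=> z /pred2P[|] -> /=; rewrite ?e eqxx ?orbT.
Qed.

Lemma alternates_commeq u w e h p : commeq m u w -> alternates u e h p ->
  alternates w e h p.
Proof.
elim=> {u w} [//|u v w _ IH1 _ IH2 /IH1/IH2 //|u w x y xy].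
have [xSy ySx] : lv x <> (lv y).+1 /\ lv y <> (lv x).+1 by case/D_commute: xy.
move=> [ru fu]; have xy0 : ~~ (is_t x && is_t y).
  apply/negP => /andP[/eqP x0 /eqP y0]; move/negP: (realizes_no_square 0 ru); apply.
  by apply/infixP; exists (levels u), (levels w); rewrite /levels map_cat /= x0 y0.
split; last first.
  by rewrite -fu !filter_cat /=; move: xy0; case: (lv x == 0); case: (lv y == 0).
apply: realizes_proj ru (levels_lt _ n0) _ => i _.
rewrite /levels !map_cat /proj !filter_cat /=.
case: (pred2P) => ex; case: (pred2P) => ey //.
case: ex ey => ex [] ey; rewrite ex ey // in xSy ySx *.
Qed.

Lemma blocks_commeq u w j p : commeq m u w -> blocks u j p -> blocks w j p.
Proof.
move=> uw bu e; apply: realizes_proj (bu e) (levels_lt _ n0) _ => i _.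
rewrite !proj_levels -!filter_predI; congr levels; apply: commeq_filter uw => x y.
move=> /D_commute[xy xSy ySx]; apply/negP => /= /andP[/andP[lx xe] /andP[ly ye]].
have exy : lv x = lv y.
  by case/pred2P: lx ly xSy ySx => -> /pred2P[|] ->.
have [x0|/level_inj_pos/(_ exy) //] := posnP (lv x).
have y0 : lv y = 0 by rewrite -exy.
move/eqP/is_tP: x0 => [c ec]; move/eqP/is_tP: y0 => [c' ec']; subst x y.
by case: e c c' xe ye xy {lx ly xSy ySx exy} => [] [] [].
Qed.

Lemma alternates_inj u w e h p : alternates u e h p -> alternates w e h p ->
  commeq m u w.
Proof.
move=> [[_ ru] fu] [[_ rw] fw];
  apply: commeq_of_proj => x y /noncommuting_pair[i ni Pi].
pose P z := pred2 i i.+1 (lv z).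
have F v : filter (pred2 x y) v = filter (pred2 x y) (filter P v).
  rewrite -filter_predI; apply: eq_filter => z.
  by apply/idP/andP => [zxy|[]//]; split=> //; exact: Pi.
rewrite F [RHS]F; congr filter; apply: levels_inj.
  by rewrite -!proj_levels ru // rw.
have C v : filter is_t (filter P v) = filter P (filter is_t v).
  by rewrite -!filter_predI; apply: eq_filter => z /=; rewrite andbC.
by rewrite !C fu fw.
Qed.

Lemma blocks_inj u w j p : blocks u j p -> blocks w j p -> commeq m u w.
Proof.
move=> bu bw; apply: commeq_of_proj => x y /[dup] xy /noncommuting_pair[i ni Pi].
have [e xe ye] : exists2 e, x != t e & y != t e.
  case: x y xy {Pi} => [c|k] [d|l].
  - move=> /D_not_commute[[->]|//|//]; exists (~~ d); by case: (d).
  - by move=> _; exists (~~ c) => //; case: (c).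
  - by move=> _; exists (~~ d) => //; case: (d).
  - by move=> _; exists true.
pose P z := pred2 i i.+1 (lv z).
have F v : filter (pred2 x y) v = filter (pred2 x y) (filter P (erase e v)).
  rewrite -!filter_predI; apply: eq_filter => z.
  apply/idP/andP => [zxy|[/andP[]//]]; split; last by case/pred2P: zxy => ->.
  by apply/andP; split=> //; exact: Pi.
rewrite F [RHS]F; congr filter; apply: (@levels_inj_erased e).
- by rewrite -!proj_levels (bu e).2 // (bw e).2.
- by rewrite !mem_filter /= eqxx andbF.
- by rewrite !mem_filter /= eqxx andbF.
Qed.

Lemma color_ex (e : bool) v : all (fun i => i < n) v -> exists w,
  levels w = v /\ filter is_t w = altw (count_mem 0 v) (t e) (t (~~ e)).
Proof.
elim: v e => [|i v IH] e /=; first by exists [::].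
case/andP=> ni vn; case: i ni => [|i] ni.
  have [w [<- fw]] := IH (~~ e) vn; exists (t e :: w); split=> //=.
  by rewrite fw negbK.
have [x ex] := level_ex true ni; have [w [<- fw]] := IH e vn.
by exists (x :: w); rewrite /= ex /= fw.
Qed.

Lemma alternates_ex e h p : code_ok n 0 h p -> exists w, alternates w e h p.
Proof.
move=> ok; have [v rv] := realizes_ex ok; have [w [ew fw]] := color_ex e rv.1.
by exists w; split; rewrite ?ew // fw (realizes_count0 ok rv).
Qed.

Lemma blocks_ex j p : code_ok n j 1 p -> exists w, blocks w j p.
Proof.
move=> ok; have [v rv] := realizes_ex ok; have c0 := realizes_count0 ok rv.
have /split_first[a [b [ev _]]] : 0 \in v by rewrite -has_pred1 has_count c0.
have := rv.1; rewrite ev all_cat /= => /and3P[an _ bn].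
have [a' ea] := levels_ex true an; have [b' eb] := levels_ex true bn.
move: c0; rewrite ev count_cat /= => /sum_eq1[/count_memPn a0 /count_memPn b0].
exists (a' ++ t true :: t false :: b') => e.
have no_t w : 0 \notin levels w -> erase e w = w.
  move=> w0; apply/all_filterP/allP => x xw /=; apply: contra w0 => /eqP ex.
  by apply/mem_levels0; exists e; rewrite -ex.
rewrite filter_cat (_ : erase e (_ :: _) = t (~~ e) :: b'); last first.
  by case: e no_t => no_t /=; rewrite no_t // eb.
by rewrite no_t ?ea // /levels map_cat /= -/(levels a') -/(levels b') ea eb -ev.
Qed.

(** If both held, t_1 and t_2 would occur once each with a letter s_1 between
    them, and this s_1 would be after the letter kept by one erasure and before
    the letter kept by the other. *)
Lemma alternates_not_blocks w e h p j q : code_ok n j 1 q ->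
  alternates w e h p -> ~ blocks w j q.
Proof.
move=> ok [rw fw] bw.
have c1 c : count_mem (t c) w = 1.
  have := realizes_count0 ok (bw (~~ c)); rewrite count_map => <-.
  rewrite count_filter; apply: eq_count => x /=.
  by case: x => [d|i] //=; case: c d => [] [].
have h2 : h = 2.
  have := count_altw_head h (_ : t e != t (~~ e));
    have := count_altw_tail h (_ : t e != t (~~ e)).
  rewrite -fw !count_mem_filter // !c1.
  have -> : t e != t (~~ e) by case: (e).
  move=> /(_ isT) h1 /(_ isT) h3; have := odd_double_half h; rewrite -h1.
  by have := uphalf_half h; rewrite -h1 -h3; case: (odd h) => //= _ <-.
rewrite h2 /= in fw.
have [a [b' [ew ea eb']]] := filter_split (a := [::]) fw.
have [b [c [ew' eb ec]]] := filter_split (a := [::]) eb'.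
have no0 v : filter is_t v = [::] -> 0 \notin levels v.
  move=> fv; apply/negP => /mem_levels0[d dv];
    have : t d \in filter is_t v by rewrite mem_filter.
  by rewrite fv.
have no_t v d : filter is_t v = [::] -> erase d v = v.
  move=> fv; apply/all_filterP/allP => x xv /=; apply/eqP => ex.
  have : x \in filter is_t v by rewrite mem_filter xv ex.
  by rewrite fv.
have Z v : filter is_t v = [::] -> 0 \notin proj 0 (levels v).
  by move=> /no0; rewrite mem_filter negb_and orbC => ->.
subst b' w.
have E1 := (bw e).2 0 n0; have E2 := (bw (~~ e)).2 0 n0.
move: E2; rewrite -E1 !filter_cat /= !filter_cat /= !eqxx /= !no_t //.
have -> : t e != t (~~ e) by case: (e).
have -> : t (~~ e) != t e by case: (e).
rewrite /levels !map_cat /= !map_cat /= /proj !filter_cat /= !filter_cat /=.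
move=> /eqP; rewrite eqseq_cat // eqxx /= => /eqP.
have := Z b eb; rewrite /proj.
case eY: (filter _ (map lv b)) => [|y Y] /=; last first.
  by rewrite inE => /norP[y0 _] [ey]; rewrite ey eqxx in y0.
move=> _ _; have := rw.2 0 n0 => E; move/negP: (@code_edge_no_ll 0 h p 0 isT); apply.
rewrite -E; apply/infixP; exists (proj 0 (levels a)), (proj 0 (levels c)).
by rewrite /levels map_cat /= map_cat /proj /= filter_cat /= filter_cat eY.
Qed.

Lemma coxD_braid x y : 2 < m x y -> m x y = 3 /\
  [\/ exists i, lv x = i.+1 /\ lv y = i.+2, exists i, lv x = i.+2 /\ lv y = i.+1,
      exists e, x = t e /\ lv y = 1 | exists e, y = t e /\ lv x = 1].
Proof.
move=> m3; have m3E : m x y = 3 by have := coxD_le3 x y; lia.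
split=> //; case: (@D_not_commute x y); first by rewrite m3E.
- by move=> e; rewrite e cox_diag in m3.
- move=> e; have [y0|] := posnP (lv y); last by case: (lv y) e => // i e _;
  constructor 2; exists i.
  by rewrite y0 in e; move/eqP/is_tP: y0 => [c ->]; constructor 4; exists c.
- move=> e; have [x0|] := posnP (lv x); last by case: (lv x) e => // i e _;
  constructor 1; exists i.
  by rewrite x0 in e; move/eqP/is_tP: x0 => [c ->]; constructor 3; exists c.
Qed.

Lemma infix_levels s u : infix s u -> infix (levels s) (levels u).
Proof.
by move=> /infixP[a [b ->]]; apply/infixP; exists (levels a), (levels b);
  rewrite /levels !map_cat.
Qed.

Lemma alternates_allowed u e h p : code_ok n 0 h p -> alternates u e h p ->
  ~ forbidden m u.
Proof.
move=> ok [ru fu] [a [b [x [y]]]].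
have inf s : u = a ++ s ++ b -> infix s u by move=> ->; apply/infixP; exists a, b.
case=> [/(inf [:: x; x])/infix_levels|[/coxD_braid[m3 xy] /inf]].
  by rewrite /= (negbTE (realizes_no_square _ ru)).
rewrite m3 /= => /[dup] iu /infix_levels/=.
case: xy => [[i [-> ey]]|[i [-> ey]]|[c [ex ey]]|[c [ex ey]]].
- rewrite ey (negbTE (realizes_no_braid3_up ok ru _)) //.
  by rewrite -ey level_lt.
- move=> iv; move: (iv); rewrite ey (negbTE (realizes_no_braid3_down ok ru _)) //.
  by apply: (allP ru.1); apply: (mem_infix iv); rewrite mem_head.
- move=> _; have := infix_filter is_t iu.
  rewrite ex /= ey fu => /infix_alternating; rewrite /alternating /= eqxx.
  by move=> /(_ (alternating_altw _ _)) h'; case: (e) h' => h'; have := h' isT.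
- by rewrite ex /= ey (negbTE (realizes_no_101 ru _ hn)).
Qed.

Lemma blocks_allowed u j p : code_ok n j 1 p -> blocks u j p -> ~ forbidden m u.
Proof.
move=> ok bu [a [b [x [y]]]].
have inf s : u = a ++ s ++ b -> infix s u by move=> ->; apply/infixP; exists a, b.
case=> [/(inf [:: x; x]) iu|[/coxD_braid[m3 xy] /inf]].
  have [c xc] : exists c, x != t c.
    by case: (x) => [c|i]; [exists (~~ c); case: c|exists true].
  have := infix_levels (infix_filter (predC1 (t c)) iu).
  by rewrite /= xc /= (negbTE (realizes_no_square _ (bu c))).
rewrite m3 /= => iu.
have pos z i : lv z = i.+1 -> forall c, z != t c.
  by move=> ez c; apply: contra_eqN ez => /eqP ->.
case: xy => [[i [ex ey]]|[i [ex ey]]|[c [ex ey]]|[c [ex ey]]].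
- have := infix_levels (infix_filter (predC1 (t true)) iu).
  rewrite /= (pos _ _ ex) (pos _ _ ey) /= ex ey.
  by rewrite (negbTE (realizes_no_braid3_up ok (bu true) _)) // -ey level_lt.
- have := infix_levels (infix_filter (predC1 (t true)) iu).
  rewrite /= (pos _ _ ex) (pos _ _ ey) /= ex ey.
  by rewrite (negbTE (realizes_no_braid3_down ok (bu true) _)) // -ex level_lt.
- have := infix_levels (infix_filter (predC1 (t (~~ c))) iu).
  rewrite /= (pos _ _ ey) ex (_ : t c != t (~~ c)); last by case: (c).
  rewrite /= ey => /infixP[a' [b' e]]; have := realizes_count0 ok (bu (~~ c)).
  by rewrite -/(levels _) e !count_cat /=; lia.
- have := infix_levels (infix_filter (predC1 (t c)) iu).
  by rewrite /= (pos _ _ ey) ex eqxx /= (negbTE (realizes_no_square _ (bu c))).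
Qed.

Lemma fcword_blocks u : fcword m u -> ~ separated u -> exists j p,
  code_ok n j 1 p /\ blocks u j p.
Proof.
move=> fu /(not_separated fu)[a [c [d uw]]].
have fw := fcword_commeq uw fu.
have [gw c0] := adjacent_gap_conditions fw (erefl _).
have [a0 d0] := adjacent_unique fw (erefl _).
have [j [h [p [ok rw _]]]] := gap_conditions_realizes gw n0.
have h1 : h = 1 by rewrite -c0 (realizes_count0 ok rw).
subst h; exists j, p; split=> //; apply: blocks_commeq (commeq_sym uw) _ => e.
have no_t v : 0 \notin levels v -> erase e v = v.
  move=> v0; apply/all_filterP/allP => x xv /=; apply: contra v0 => /eqP ex.
  by apply/mem_levels0; exists e; rewrite -ex.
rewrite filter_cat no_t // (_ : erase e (_ :: _) = t (~~ e) :: d); last first.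
  by case: e c {fw uw gw c0 rw} no_t => [] [] no_t /=; rewrite no_t.
by move: rw; rewrite /levels !map_cat.
Qed.

(** A chain would contain a gap of s_1 without s_2, hence with two letters t_1 or
    t_2, and s_1 does not separate them. Two consecutive letters t_1 with no t_2
    between them would enclose two letters s_1 without t_1 or t_2 between them. *)
Lemma fcword_alternates u : fcword m u -> separated u -> exists e h p,
  [/\ code_ok n 0 h p, alternates u e h p & (h == 0) ==> e].
Proof.
move=> fu su; have gu := separated_gap_conditions fu su.
have [j [h [p [ok ru pj]]]] := gap_conditions_realizes gu n0.
have j0 : j = 0.
  case: (posnP j) => // /pj[a [b [c [e b1 b2]]]].
  have [a' [x [b' [c' [eu ex _ eb _]]]]] := split_levelsD e.
  have := fcwordD_gap fu eu ex; rewrite eb (count_memPn b2) addn0.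
  move=> /(_ b1) /split_two[d1 [d2 [d3 [ed d20]]]].
  have := gap_0 gu (a := a ++ 1 :: d1) (b := d2) (c := d3 ++ 1 :: c).
  rewrite e ed -?catA /= -?catA => /(_ erefl d20) d21.
  by move: b1; rewrite ed mem_cat inE mem_cat d21 !orbT.
subst j; have alt : alternating (filter is_t u).
  suff no2 a b x : filter is_t u <> a ++ x :: x :: b.
    elim: (filter is_t u) no2 => // x s IH no2; case: s IH no2 => // y s IH no2 /=.
    apply/andP; split; first by apply/eqP => exy; subst y; exact: (no2 [::] s x).
    by apply: IH => a b z e; apply: (no2 (x :: a) b z); rewrite e.
  move=> e; have [a' [b' [eu _ eb]]] := filter_split e.
  have [d [c [eb' ed _]]] := filter_split (a := [::]) eb.
  have : x \in filter is_t u by rewrite e mem_cat mem_head orbT.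
  rewrite mem_filter => /andP[/is_tP[c0 ex] _]; subst x b'.
  have d0 : 0 \notin levels d.
    apply/negP => /mem_levels0[c1 c1d];
      have : t c1 \in filter is_t d by rewrite mem_filter.
    by rewrite ed.
  have := factor_no_t fu (x := a' ++ [:: t c0]) (s := d) (y := t c0 :: c).
  rewrite -catA => /(_ eu d0); rewrite leqNgt => /negP; apply.
  apply: (fcwordD_gap0 fu eu).
  by apply: contra d0 => cd; apply/mem_levels0; exists c0.
have sh : size (filter is_t u) = h.
  rewrite -(realizes_count0 ok ru) size_filter /levels count_map.
  by apply: eq_count => x /=.
have sub : {subset filter is_t u <= pred2 (t true) (t false)}.
  by move=> x; rewrite mem_filter => /andP[/is_tP[[] ->] _].
have [h0|hpos] := eqVneq h 0.
  exists true, h, p; split=> //; last by rewrite implybT.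
  by split=> //; rewrite h0 /=; apply: size0nil; rewrite sh.
have := alternatingE alt sub (isT : t true != t false); rewrite sh.
by case=> e; [exists true|exists false]; exists h, p; split; rewrite ?(negbTE hpos).
Qed.

Lemma alternates_size u e h p : code_ok n 0 h p -> alternates u e h p ->
  size u = area h p.
Proof. by move=> ok [/(realizes_size ok)]; rewrite size_map. Qed.

Lemma blocks_size u j p : code_ok n j 1 p -> blocks u j p ->
  size u = (2 * j + area 1 p).+1.
Proof.
move=> ok bu; have := realizes_size ok (bu true); rewrite size_map => <-.
have := realizes_count0 ok (bu false); rewrite count_map count_filter => c1.
rewrite -(count_predC (pred1 (t true)) u) size_filter -addn1 addnC; congr (_ + _).
rewrite -{}c1; apply: eq_count => x /=.
by case: x => [[]|i].
Qed.

Lemma alternates_fun u e h p e' h' p' : code_ok n 0 h p -> code_ok n 0 h' p' ->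
  alternates u e h p -> alternates u e' h' p' -> (h == 0) ==> e -> (h' == 0) ==> e' ->
  [/\ e = e', h = h' & p = p'].
Proof.
move=> ok ok' [ru fu] [ru' fu'] he he'; have [_ eh ep] := realizes_fun ok ok' ru ru'.
subst h' p'; split=> //; move: fu'; rewrite fu.
by case: h he he' {ok ok' ru ru' fu} => [/= -> ->|h _ _ []].
Qed.

Local Open Scope ring_scope.

Definition cartanD x y : int :=
  if x == y then 2 else if (lv x == (lv y).+1) || (lv y == (lv x).+1) then -1 else 0.

Lemma cartanD_diag x : cartanD x x = 2.
Proof. by rewrite /cartanD eqxx. Qed.

Lemma cartanD_off x y : x <> y ->
  [\/ [/\ m x y = 2%N, cartanD x y = 0 & cartanD y x = 0],
      [/\ m x y = 3%N, cartanD x y = -1 & cartanD y x = -1],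
      [/\ m x y = 4%N, cartanD x y = -1 & cartanD y x = -2] |
      [/\ m x y = 4%N, cartanD x y = -2 & cartanD y x = -1]].
Proof.
move=> /eqP/negbTE xy; rewrite coxD_level /cartanD (eq_sym y x) xy.
rewrite (orbC (lv y == _)).
by case: ifP => _; [constructor 2|constructor 1].
Qed.
End TypeD.

(** Without letters t_1 and t_2 the two colourings coincide, so the second list
    omits the walks from height 0. *)
Definition codesD n : seq (bool * code + code) :=
  [seq inl (true, c) | c <- codes_head n]
  ++ [seq inl (false, c) | c <- codes_head n & c.1.2 != 0]
  ++ [seq inr c | c <- codes_chain n 0].

Definition codeD_size (c : bool * code + code) :=
  match c with inl (_, c) => code_size c | inr c => (code_size c).+1 end.

Definition realizesD n (u : seq (bool + 'I_n.-1))
    (c : bool * code + code) :=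
  match c with
  | inl (e, c) => alternates u e c.1.2 c.2
  | inr c => blocks u c.1.1 c.2
  end.

Lemma mem_codesD_inl n e c : (0 < n)%N -> (inl (e, c) \in codesD n) =
  [&& c.1.1 == 0%N, code_ok n c.1.1 c.1.2 c.2 & (c.1.2 == 0%N) ==> e].
Proof.
move=> n0; rewrite /codesD !mem_cat [X in _ || (_ || X)](_ : _ = false); last first.
  by apply/negP => /mapP[].
rewrite orbF; case: e.
  rewrite mem_map; last by move=> ? ? [].
  rewrite mem_codes_head // implybT andbT.
  by rewrite [X in _ || X](_ : _ = false) ?orbF //; apply/negP => /mapP[? _ []].
rewrite [X in X || _](_ : _ = false); last by apply/negP => /mapP[? _ []].
rewrite mem_map; last by move=> ? ? [].
by rewrite mem_filter mem_codes_head // implybF andbC -andbA.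
Qed.

Lemma mem_codesD_inr n c : (0 < n)%N -> (inr c \in codesD n) =
  (c.1.2 == 1%N) && code_ok n c.1.1 c.1.2 c.2.
Proof.
move=> n0; rewrite /codesD !mem_cat mem_map; last by move=> ? ? [].
rewrite mem_codes_chain leq0n.
rewrite [X in X || _](_ : _ = false); last by apply/negP => /mapP[].
by rewrite [X in _ || (X || _)](_ : _ = false) //; apply/negP => /mapP[].
Qed.

Lemma uniq_codesD n : uniq (codesD n).
Proof.
rewrite /codesD !cat_uniq !map_inj_uniq; try by move=> ? ? [].
rewrite filter_uniq ?uniq_codes_head ?uniq_codes_chain //= andbT.
apply/andP; split.
  apply/hasPn => c; rewrite mem_cat => /orP[/mapP[d _ ->]|/mapP[d _ ->]];
    by apply/mapP => -[].
by apply/hasPn => c /mapP[d _ ->]; apply/mapP => -[].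
Qed.

Local Open Scope ring_scope.

Theorem FCpoly_D n : (2 <= n)%N ->
  FCpoly (coxDS n) = \sum_(c <- codesD n) 'X^(codeD_size c).
Proof.
move=> hn; have n0 : (0 < n)%N by exact: ltnW.
apply: (@FCpoly_codes _ _ _ _ _ _ _ (@realizesD n)).
- exact: crystallographic_gt0 (@cartanD_off n).
- exact: crystallographic_exact (@cartanD_diag n) (@cartanD_off n).
- exact: uniq_codesD.
- move=> u v [[e c]|c] uv /=; first exact: alternates_commeq.
  exact: blocks_commeq.
- move=> u fu; have [su|su] := pselect (separated u).
    have [e [h [p [ok au eh]]]] := fcword_alternates hn fu su.
    by exists (inl (e, (0, h, p))); rewrite ?mem_codesD_inl //= ok.
  have [j [p [ok bu]]] := fcword_blocks hn fu su.
  by exists (inr (j, 1, p)); rewrite ?mem_codesD_inr //= ok.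
- move=> [[e [[j h] p]]|[[j h] p]]; rewrite ?mem_codesD_inl ?mem_codesD_inr //=.
    by case/and3P=> /eqP -> ok _; exact: (alternates_ex e ok).
  by case/andP=> /eqP -> ok; exact: (blocks_ex ok).
- move=> u [[e [[j h] p]]|[[j h] p]]; rewrite ?mem_codesD_inl ?mem_codesD_inr //=.
    by case/and3P=> /eqP -> ok _; exact: alternates_allowed.
  by case/andP=> /eqP -> ok; exact: blocks_allowed.
- move=> u v [[e c]|c] _ /=; first exact: alternates_inj.
  exact: blocks_inj.
- move=> u [[e [[j h] p]]|[[j h] p]] [[e' [[j' h'] p']]|[[j' h'] p']];
    rewrite ?mem_codesD_inl ?mem_codesD_inr //=.
  + case/and3P=> /eqP -> ok eh /and3P[/eqP -> ok' eh'] au au'.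
    by have [-> -> ->] := alternates_fun ok ok' au au' eh eh'.
  + case/and3P=> /eqP -> ok _ /andP[/eqP -> ok'] au bu.
    by case: (alternates_not_blocks hn ok' au bu).
  + case/andP=> /eqP -> ok' /and3P[/eqP -> ok _] bu au.
    by case: (alternates_not_blocks hn ok' au bu).
  + case/andP=> /eqP -> ok /andP[/eqP -> ok'] bu bu'.
    by have [-> _ ->] := realizes_fun ok ok' (bu true) (bu' true).
- move=> u [[e [[j h] p]]|[[j h] p]]; rewrite ?mem_codesD_inl ?mem_codesD_inr //=.
    by case/and3P=> /eqP -> ok _; exact: alternates_size.
  by case/andP=> /eqP -> ok; exact: blocks_size.
Qed.

Corollary FCpoly_D_series n : (2 <= n)%N -> FCpoly (coxDS n) =
    fcoef (2%:R * Qstarx - Mstarx + sx * sq ^+ 2 / (1 - sx * sq ^+ 2)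
                    * Mstarx * fps_dilate 'X Mx) n.
Proof.
move=> hn; have n0 : (0 < n)%N by exact: ltnW.
have E1 : \sum_(c <- codes_head n) 'X^(codeD_size (inl (true, c))) = fcoef Qstarx n
  by exact: sum_codes_head.
have E2 : \sum_(c <- [seq c <- codes_head n | c.1.2 != 0%N]) 'X^(codeD_size (inl (false, c)))
    = fcoef Qstarx n - fcoef Mstarx n.
  rewrite big_filter big_mkcond -sum_codes_head fcoef_Mstarx /codes_head.
  rewrite -[iota 0 n.+1]/(0%N :: iota 1 n) big_allpairs_dep [in RHS]big_allpairs_dep.
  rewrite !big_cons big1 // [LHS]add0r [RHS]addrC [RHS]addKr.
  rewrite !big_seq; apply: eq_bigr => h; rewrite mem_iota => /andP[h0 _].
  by apply: eq_bigr => p _; rewrite ifT // -lt0n.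
have E3 : \sum_(c <- codes_chain n 0) 'X^(codeD_size (inr c)) =
    \sum_(0 <= j < n) 'X^((2 * j).+1) * walk_poly true (n - j) 1.
  under eq_bigr do rewrite exprS; rewrite -big_distrr sum_codes_chain // big_distrr.
  by apply: eq_bigr => j _; rewrite exprS -mulrA.
rewrite FCpoly_D // /codesD !big_cat !big_map E1 E2 E3.
rewrite mulr_natl mulr2n !fcoefD fcoefN fcoef_D_blocks // [LHS]addrA.
congr (_ + _); exact: addrA.
Qed.

Theorem proposition4p6 (n : nat) (hn : (2 <= n)%N) :
  FCpoly (coxB n) =
    fcoef (Qstarx + sx ^+ 2 * sq ^+ 3 / (1 - sx * sq ^+ 2)
                    * Mstarx * fps_dilate 'X Mx) n /\
  FCpoly (coxDS n) =
    fcoef (2%:R * Qstarx - Mstarx + sx * sq ^+ 2 / (1 - sx * sq ^+ 2)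
                    * Mstarx * fps_dilate 'X Mx) n.
Proof. by split; [exact: FCpoly_B_series|exact: FCpoly_D_series]. Qed.
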